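(* Fix $k\in\mathbb N$ and let $p_{\mathbb P_k}(n)$ be the number of partitions of $n$ with all parts in $\mathbb P_k=\{p^k: p\text{ prime}\}$. Let $\Psi(z)=\prod_{p\text{ prime}}(1-z^{p^k})^{-1}$ and $\Phi(z)=\sum_{j=1}^\infty\sum_{p\text{ prime}}\frac1j z^{jp^k}$ for $|z|<1$. Let $\rho=\rho(n)\in(0,1)$ be defined by $n=\rho\Phi'(\rho)$ and let $\Phi_{(2)}(\rho)=\left(\rho\frac{d}{d\rho}\right)^2\Phi(\rho)$. Then $$p_{\mathbb P_k}(n+1)-p_{\mathbb P_k}(n)\sim\frac{\rho^{-n}\log(\frac1\rho)\Psi(\rho)}{\sqrt{2\pi\Phi_{(2)}(\rho)}}\left(1+O\left(n^{-\frac1{2k+3}}\right)\right).$$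
   Context: The map $\rho\mapsto\rho\Phi'(\rho)$ is continuous and strictly increasing on $(0,1)$ tending to $\infty$ as $\rho\to1^-$, so $\rho(n)$ is well defined for large $n$. Implicit constants may depend on $k$. *)

(* Defs.v *)
From HB Require Import structures.
From mathcomp Require Import all_boot all_order all_algebra.
From mathcomp Require Import all_classical all_reals all_analysis.
Set Implicit Arguments. Unset Strict Implicit. Unset Printing Implicit Defensive.
Import Order.TTheory GRing.Theory Num.Theory numFieldNormedType.Exports.
Local Open Scope ring_scope.

Definition in_Pk (k m : nat) : bool := [exists p : 'I_m.+1, prime p && (m == p ^ k)%N].

(* p_{P_k}(n): number of partitions of n with all parts in P_k, counted as
   multiplicity functions f (f i = number of parts equal to i, i <= n)
   supported on P_k with \sum_i i * f i = n. *)
Definition pPk (k n : nat) : nat :=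
  #|[set f : {ffun 'I_n.+1 -> 'I_n.+1} |
      [forall i : 'I_n.+1, (f i != ord0) ==> in_Pk k i] && ((\sum_(i : 'I_n.+1) (i : nat) * (f i : nat))%N == n)]|.

Definition sum_primes (R : realType) (F : nat -> R) : R :=
  limn (fun N : nat => (\sum_(p < N | prime p) F p : R)).

Definition Phi (R : realType) (k : nat) (z : R) : R :=
  limn (fun J : nat => (\sum_(1 <= j < J) sum_primes (fun p => (j%:R)^-1 * z ^+ (j * p ^ k)) : R)).

Definition Psi (R : realType) (k : nat) (z : R) : R :=
  limn (fun N : nat => (\prod_(p < N | prime p) (1 - z ^+ (p ^ k))^-1 : R)).

Definition Phi2 (R : realType) (k : nat) (rho : R) : R :=
  rho * derive1 (fun x => x * derive1 (Phi k) x) rho.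

(* Main.v *)
(* Write [rho = e^{-a}] and [X = 1/a]. For the finite set [S] of the [p^k] with [p < M], the
   difference [p(n+1) - p(n)] is the integral over [0 <= t <= pi] of the real part of
   [rho^{-n} (e^{a+it} - 1) Psi_S(rho e^{-it}) e^{int} / pi]. Each factor of
   [Psi_S] is split into modulus and argument, so that only real analysis is needed.
   Near [t = 0], for [t <= delta = X^{-1-1/(2k)+epsilon}], the saddle point equation cancels the
   linear phase and the integrand is a Gaussian up to an error governed by the moments
   [\sum_s s^j rho^s / (1 - rho^s)^j], which are [O(X^j X^{1/k})].
   Outside, no bound for Weyl sums is needed: it suffices that [Psi_S] loses an arbitrary power of
   [X]. Every [s = p^k <= X] for which [s t] is not close to [2 pi Z] costs
   [|Psi_S|^2] a factor [1 + c (X t)^2]. For [t <= X^{-1/2}]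
   Chebyshev's lower bound yields enough such primes; for larger [t], Bezout shows that at most one
   prime of a fixed finite set can fail.
   All estimates are uniform in [M], so [M] may tend to infinity at the end, when the finite
   moments tend to [rho Phi'(rho)] and [Phi_(2)(rho)], read off the power series of [Phi]. *)
Require Import Defs.
From HB Require Import structures.
From mathcomp Require Import all_boot all_order all_algebra.
From mathcomp Require Import all_classical all_reals all_analysis.
From mathcomp Require Import ring lra zify.
Import Order.TTheory GRing.Theory Num.Theory numFieldNormedType.Exports.
Set Implicit Arguments. Unset Strict Implicit. Unset Printing Implicit Defensive.
Local Open Scope ring_scope.

(** * Partitions with prescribed parts *)

(** The exponent [1/(2k+3)] comes from treating the saddle point errors in absolute value only. The
    cubic phase term costs a relative error of about [X^(-1/(2k))], and since [n] is at most a
    constant times [X^(1+1/k)], this is [O(n^(-1/(2k+2)))] up to small powers of [X]. The weaker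
    exponent in the theorem pays for those small powers. In units of [W] with [X^(1/k) = W^(8e)] and
    [e = 2k+3], the margin is four powers of [W], because [4e = 8(k+1) + 4]: three are spent on the
    cube of the slightly widened central arc, and one on the length of that arc. The difference
    [p(n+1) - p(n)] carries the factor [e^(a+it) - 1], which is only about [a] at the saddle. Every
    error must therefore be small compared with [a] times the Gaussian mass, including the error
    made on the minor arcs. Truncating the primes spoils the saddle point equation slightly, so the
    finite estimates ask only that [n] be within 1 of the first moment. The cost is a phase error of
    at most [t]. *)

Fixpoint part_count (S : seq nat) (n : nat) : nat :=
  if S is s :: S' then (\sum_(j < n.+1 | s * j <= n) part_count S' (n - s * j))%N
  else (n == 0)%N.

(** Either no part equals [s], or one copy of [s] can be removed. The Fourier integrals below
    satisfy the same recursion, which is how they are identified with partition counts. *)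
Lemma part_count_rec (s : nat) (S : seq nat) (n : nat) : (0 < s)%N ->
  part_count (s :: S) n =
  (part_count S n + (if (s <= n)%N then part_count (s :: S) (n - s) else 0))%N.
Proof.
move=> s_gt0 /=; rewrite big_mkcond big_ord_recl /= muln0 leq0n subn0; congr (_ + _)%N.
case: ifP => sn; last first.
  rewrite big1// => i _; rewrite /bump /= add1n mulnS.
  by rewrite ifF//; apply/negbTE; rewrite -ltnNge; move: sn; lia.
have [m nE] : exists m, n = (m + (n - s).+1)%N.
  by exists (n - (n - s).+1)%N; rewrite subnK//; lia.
rewrite [RHS]big_mkcond /=.
rewrite -(big_mkord xpredT (fun i => if (s * i <= n - s)%N then
  part_count S (n - s - s * i) else 0%N)).
rewrite -(big_mkord xpredT (fun i => if (s * bump 0 i <= n)%N then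
  part_count S (n - s * bump 0 i) else 0%N)).
rewrite (@big_cat_nat _ _ _ (n - s).+1 0 n)//=; last by lia.
rewrite [X in (_ + X)%N]big_nat_cond [X in (_ + X)%N]big1 ?addn0; last first.
  move=> i; rewrite andbT => /andP[h1 h2]; rewrite ifF// /bump /=; apply/negbTE; rewrite -ltnNge.
  rewrite add1n mulnS; have := leq_pmull i s_gt0; lia.
apply: eq_big_nat => i _; rewrite /bump /= add1n mulnS.
rewrite -subnDA; congr (if _ then _ else _); lia.
Qed.

(** Cutting each geometric series after [j = N] does not affect degrees up to [N], since [s >= 1];
    polynomials can thus replace formal power series. *)
Lemma coef_prod_geom (N : nat) (S : seq nat) (n : nat) :
  all (fun s => 0 < s)%N S -> (n <= N)%N ->
  (\prod_(s <- S) \sum_(j < N.+1) 'X^(s * j) : {poly int})`_n = (part_count S n)%:R.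
Proof.
elim: S n => [|s S IH] n /=; first by rewrite big_nil coef1; case: n.
move=> /andP[s_gt0 S_gt0] nN.
rewrite big_cons mulr_suml coef_sum.
rewrite (eq_bigr (fun j : 'I_N.+1 => if (s * j <= n)%N then
   (part_count S (n - s * j))%:R else 0)); last first.
  move=> j _; rewrite coefXnM ltnNge; case: leqP => //= h.
  by rewrite IH// (leq_trans (leq_subr _ _)).
rewrite natr_sum -big_mkcond /=.
rewrite [RHS](big_ord_widen_cond N.+1 (fun j => (s * j <= n)%N)
  (fun j => (part_count S (n - s * j))%:R : int)); last by lia.
apply: eq_bigl => j; rewrite ltnS; case: (leqP j n) => h; rewrite ?andbT ?andbF//.
by apply/negbTE; rewrite -ltnNge (leq_trans h)// leq_pmull.
Qed.

Definition prime_powers (k M : nat) : seq nat := [seq (p ^ k)%N | p <- iota 0 M & prime p].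

Lemma prime_powers_gt0 k M : all (fun s => 0 < s)%N (prime_powers k M).
Proof.
by apply/allP => s /mapP[p]; rewrite mem_filter => /andP[/prime_gt0 p0 _] ->; rewrite expn_gt0 p0.
Qed.

Lemma big_prime_powers (T : Type) (idx : T) (op : Monoid.law idx) (k M : nat) (F : nat -> T) :
  \big[op/idx]_(s <- prime_powers k M) F s = \big[op/idx]_(p < M | prime p) F (p ^ k)%N.
Proof. by rewrite big_map big_filter -(big_mkord prime (fun p => F (p ^ k)%N)) /index_iota subn0. Qed.

Lemma mem_prime_powers (k n M i : nat) : (0 < k)%N -> (i <= n < M)%N ->
  (i \in prime_powers k M) = in_Pk k i.
Proof.
move=> k_gt0 /andP[i_n n_M]; apply/mapP/existsP.
  move=> [p]; rewrite mem_filter => /andP[p_pr _] iE.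
  have p_i : (p < i.+1)%N by rewrite ltnS iE -{1}(expn1 p) leq_pexp2l// prime_gt0.
  by exists (Ordinal p_i); rewrite /= p_pr iE eqxx.
move=> [p /andP[p_pr /eqP ->]]; exists (p : nat) => //.
rewrite mem_filter p_pr mem_iota /= add0n; have := ltn_ord p; lia.
Qed.

Lemma prime_powers_uniq (k M : nat) : (0 < k)%N -> uniq (prime_powers k M).
Proof.
move=> k_gt0; rewrite map_inj_uniq ?filter_uniq ?iota_uniq// => p q /eqP.
by rewrite eqn_exp2r// => /eqP.
Qed.

(** Both sides are the coefficient of degree [n] in a product of truncated geometric series: parts
    larger than [n] are harmless, and distributing the remaining product enumerates the multiplicity
    functions. *)
Lemma pPk_part_count (k n M : nat) : (0 < k)%N -> (n < M)%N ->
  pPk k n = part_count (prime_powers k M) n.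
Proof.
move=> k_gt0 n_M; apply/eqP; rewrite -(eqr_nat int); apply/eqP.
rewrite -(coef_prod_geom (prime_powers_gt0 k M) (leqnn n)).
rewrite (bigID (fun s => s <= n)%N) /=.
(* A factor with [s > n] is 1 plus terms of degree above [n], so [Q] leaves the coefficient
   unchanged. *)
set Q := \prod_(i <- _ | ~~ _) _.
have coefQ (P : {poly int}) : (P * Q)`_n = P`_n.
  rewrite /Q; elim: (prime_powers k M) (prime_powers_gt0 k M) P {Q} => [|s S IH] /=.
    by move=> _ P; rewrite big_nil mulr1.
  move=> /andP[s0 S0] P; rewrite big_cons; case: leqP => /= h; first by rewrite IH.
  rewrite mulrA IH// big_ord_recl /= muln0 expr0 mulrDr mulr1 coefD.
  rewrite mulr_sumr coef_sum big1 ?addr0// => i _.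
  by rewrite coefMXn ifT// /bump /= add1n (leq_trans h)// leq_pmulr.
rewrite coefQ {coefQ Q}.
rewrite -big_filter.
have permS : perm_eq [seq s <- prime_powers k M | (s <= n)%N]
    [seq s <- iota 0 n.+1 | in_Pk k s].
  apply: uniq_perm; rewrite ?filter_uniq ?prime_powers_uniq ?iota_uniq// => i.
  rewrite !mem_filter mem_iota /= add0n ltnS; case: leqP => i_n; rewrite ?andbF//= andbT.
  by rewrite (mem_prime_powers k_gt0 (n := n)) ?i_n.
rewrite (perm_big _ permS) big_filter big_mkcond.
have -> : iota 0 n.+1 = index_iota 0 n.+1 by rewrite /index_iota subn0.
rewrite big_mkord.
(* For [i] outside [P_k] only the term [j = 0] survives. The product can then run over all [i <= n],
   and distributivity turns it into a sum over functions [f]. *)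
rewrite (eq_bigr (fun i : 'I_n.+1 => \sum_(j < n.+1)
    (if (j != ord0) ==> in_Pk k i then 'X^(i * j) else 0 : {poly int}))); last first.
  move=> i _; case: ifP => h; first by apply: eq_bigr => j _; rewrite implybT.
  rewrite big_ord_recl eqxx /= muln0 expr0 big1 ?addr0//.
rewrite bigA_distr_bigA /= coef_sum /pPk -sum1_card natr_sum big_mkcond /=.
apply: eq_bigr => f _; rewrite inE; case: ifP => [/andP[/forallP fP /eqP fn]|fP].
  rewrite (eq_bigr (fun i : 'I_n.+1 => 'X^(i * f i))); last by move=> i _; rewrite fP.
  by rewrite prodrXr fn coefXn eqxx.
apply/esym; case: (boolP [forall i, (f i != ord0) ==> in_Pk k i]) fP => /= [/forallP fP fn|].
  rewrite (eq_bigr (fun i : 'I_n.+1 => 'X^(i * f i))); last by move=> i _; rewrite fP.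
  by rewrite prodrXr coefXn eq_sym fn.
move=> /forallPn[i iP] _; rewrite (bigD1 i)//= ifF ?mul0r ?coef0//.
exact/negbTE.
Qed.

(** * The Fourier integral *)

Section geometric_factor.
Variable R : realType.
Implicit Types r u t x psi : R.

(* With [z = r e^{-iu}], [geo_var r u = |1 - z|^2 / (1 - r)^2] and
   [geo_arg r u = arg (1 - z)], so that
   [(1 - r) / (1 - z) = geo_var r u ^ (-1/2) * e^{-i geo_arg r u}]. *)
Definition geo_var r u : R := 1 + 4 * (r / (1 - r) ^+ 2) * sin (u / 2) ^+ 2.
Definition geo_arg r u : R := atan (r * sin u / (1 - r * cos u)).

Lemma cos_half_angle u : cos u = 1 - 2 * sin (u / 2) ^+ 2.
Proof.
have {1}-> : u = (u / 2) *+ 2 by lra.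
by rewrite cos_mulr2n cos2sin2; lra.
Qed.

Lemma geo_var_ge1 r u : 0 < r < 1 -> 1 <= geo_var r u.
Proof.
move=> /andP[r0 r1]; rewrite /geo_var lerDl mulr_ge0 ?sqr_ge0// mulr_ge0//.
by rewrite divr_ge0 ?sqr_ge0// ltW.
Qed.

Lemma one_minus_rcos_gt0 r u : 0 < r < 1 -> 0 < 1 - r * cos u.
Proof. by move=> /andP[r0 r1]; have := cos_le1 u; nra. Qed.

(** With [z = r e^{-iu}], this is the real part of [(1 - z) * ((1 - r) / (1 - z)) * e^{i psi} = (1 -
    r) * e^{i psi}]. *)
Lemma geo_factor_rotation r u psi : 0 < r < 1 ->
  (Num.sqrt (geo_var r u))^-1 *
    (cos (psi - geo_arg r u) - r * cos (psi - geo_arg r u - u)) = (1 - r) * cos psi.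
Proof.
move=> r01; have d0 := one_minus_rcos_gt0 u r01.
move: (r01) => /andP[r0 r1].
set d := 1 - r * cos u in d0 *.
pose m := r * sin u.
(* [D] is [|1 - z|^2] and [q] is [|1 - z|]; the argument of [1 - z] has cosine [d / q] and sine
   [m / q]. *)
pose D := d ^+ 2 + m ^+ 2.
have D0 : 0 < D by rewrite /D ltr_wpDr ?sqr_ge0// exprn_gt0.
pose q := Num.sqrt D.
have q0 : 0 < q by rewrite sqrtr_gt0.
have qq : q ^+ 2 = D by rewrite sqr_sqrtr// ltW.
have cs := cos2Dsin2 u.
have gE : Num.sqrt (geo_var r u) = q / (1 - r).
  have -> : geo_var r u = (q / (1 - r)) ^+ 2.
    rewrite expr_div_n qq /geo_var /D /d /m.
    have sE : sin (u / 2) ^+ 2 = (1 - cos u) / 2 by rewrite (cos_half_angle u); lra.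
    rewrite sE.
    have s2 : sin u ^+ 2 = 1 - cos u ^+ 2 by lra.
    rewrite exprMn s2; field; lra.
  by rewrite sqrtr_sqr ger0_norm// divr_ge0 ?ltW// subr_gt0.
set phi := geo_arg r u.
have cphi : cos phi = d / q.
  rewrite /phi /geo_arg cos_atan -/d -/m.
  have -> : 1 + (m / d) ^+ 2 = (q / d) ^+ 2 by rewrite !expr_div_n qq /D; field; lra.
  by rewrite sqrtr_sqr ger0_norm ?divr_ge0 ?ltW// invf_div.
have sphi : sin phi = m / q.
  have := atanK (m / d); rewrite -/(geo_arg r u) -/phi /tan cphi => h.
  have {h} : sin phi = m / d * (d / q) by rewrite -h; field; apply/andP; split; lra.
  by move=> ->; field; apply/andP; split; lra.
rewrite gE !cosB sinB cphi sphi.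
have -> : cos u = (1 - d) / r by rewrite /d; field; lra.
have -> : sin u = m / r by rewrite /m; field; lra.
have -> : (q / (1 - r))^-1 * (cos psi * (d / q) + sin psi * (m / q) -
   r * ((cos psi * (d / q) + sin psi * (m / q)) * ((1 - d) / r) +
    (sin psi * (d / q) - cos psi * (m / q)) * (m / r))) =
   (1 - r) * cos psi * ((d ^+ 2 + m ^+ 2) / q ^+ 2).
  by field; repeat (apply/andP; split); lra.
by rewrite qq /D; field; rewrite -/D; lra.
Qed.

Lemma continuous_geo_var r : continuous (geo_var r).
Proof.
move=> u; rewrite /geo_var; apply: cvgD; first exact: cvg_cst.
apply: cvgM; first exact: cvg_cst.
rewrite expr2; under eq_fun do rewrite expr2.
have h : {for u, continuous (fun x => sin (x / 2))}.
  apply: continuous_comp; last exact: continuous_sin.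
  by apply: cvgM; [exact: cvg_id|exact: cvg_cst].
exact: cvgM.
Qed.

Lemma continuous_geo_arg r : 0 < r < 1 -> continuous (geo_arg r).
Proof.
move=> r01 u; rewrite /geo_arg.
apply: (@continuous_comp _ _ _ (fun x => r * sin x / (1 - r * cos x)) (@atan R)); last exact: continuous_atan.
apply: cvgM; first by apply: cvgM; [exact: cvg_cst|exact: continuous_sin].
apply: cvgV; first by rewrite gt_eqF// one_minus_rcos_gt0.
apply: cvgB; first exact: cvg_cst.
by apply: cvgM; [exact: cvg_cst|exact: continuous_cos].
Qed.

End geometric_factor.

Section coefficient_integral.
Local Open Scope classical_set_scope.
Local Open Scope ring_scope.
Variable R : realType.
Implicit Types (rho t : R) (S : seq nat).

(* [\prod_(s <- S) (1 - rho^s) / (1 - (rho e^{-it})^s) = saddle_amp S rho t * e^{-i saddle_phase S rho t}]. *)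
Definition saddle_amp (S : seq nat) rho t : R :=
  \prod_(s <- S) (Num.sqrt (geo_var (rho ^+ s) (s%:R * t)))^-1.
Definition saddle_phase (S : seq nat) rho t : R :=
  \sum_(s <- S) geo_arg (rho ^+ s) (s%:R * t).

Local Notation "'\int0pi' f" := (\int[@lebesgue_measure R]_(t in `[0%R, pi]%classic) f t)
  (at level 10).

Lemma continuous_compose (f g : R -> R) : continuous f -> continuous g ->
  continuous (fun x => g (f x)).
Proof. by move=> cf cg x; apply: continuous_comp; [exact: cf|exact: cg]. Qed.

Lemma continuous_scale (c : R) : continuous (fun x : R => c * x).
Proof. by move=> x; apply: cvgM; [exact: cvg_cst|exact: cvg_id]. Qed.

Lemma integrable_0pi (f : R -> R) : continuous f ->
  (@lebesgue_measure R).-integrable `[0%R, pi]%classic (EFin \o f).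
Proof.
move=> cf; apply: continuous_compact_integrable; first exact: segment_compact.
exact: continuous_subspaceT.
Qed.

Lemma sin_int_pi (m : int) : sin (m%:~R * pi) = 0 :> R.
Proof.
have sin_nat n : sin (n%:R * pi) = 0 :> R.
  by have := alternatingn (@sinDpi R) n 0; rewrite add0r sin0 mulr0 mulr_natl.
by case: m => n; rewrite ?NegzE ?mulrNz ?mulNr ?sinN -pmulrn sin_nat ?oppr0.
Qed.

Lemma integral_0pi_cos (m : int) : m != 0 -> \int0pi (fun t => cos (m%:~R * t)) = 0.
Proof.
move=> m0; have m0' : m%:~R != 0 :> R by rewrite intr_eq0.
have dF t : is_derive t 1 (fun t => sin (m%:~R * t) / m%:~R) (cos (m%:~R * t)).
  pose c : R := m%:~R.
  have -> : (fun t => sin (m%:~R * t) / m%:~R) = c^-1 \*: (@sin R \o (c \*: id)).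
    by apply/funext => x /=; rewrite mulrC.
  have h : is_derive t 1 (@sin R \o (c \*: id)) (c * cos (c * t)).
    have h1 : is_derive t 1 (c \*: (id : R -> R)) c.
      by apply: is_derive_eq; rewrite /= /GRing.scale /= mulr1.
    have := @is_derive1_comp _ (@sin R) (c \*: id) t _ _ (is_derive_sin _) h1.
    by move=> h; apply: (is_derive_eq h); rewrite /= mulrC.
  apply: is_derive_eq; rewrite /GRing.scale /= mulrA mulVf ?mul1r//.
have cc : continuous (fun t : R => cos (m%:~R * t)).
  exact: (continuous_compose (@continuous_scale _) (@continuous_cos R)).
have cF : continuous (fun t => sin (m%:~R * t) / m%:~R : R).
  move=> t; apply/differentiable_continuous/derivable1_diffP.
  by have [] := dF t.
rewrite /Rintegral.
rewrite (@continuous_FTC2 _ _ (fun t => sin (m%:~R * t) / m%:~R)).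
- by rewrite -EFinD /= sin_int_pi mulr0 sin0 subrr.
- exact: pi_gt0.
- exact: continuous_subspaceT cc.
- split.
  + by move=> t _; have [] := dF t.
  + by apply: cvg_at_right_filter; exact: cF.
  + by apply: cvg_at_left_filter; exact: cF.
- by move=> t _; rewrite derive1E; exact: derive_val.
Qed.

Lemma expr_pow_itv rho s : 0 < rho < 1 -> (0 < s)%N -> 0 < rho ^+ s < 1.
Proof.
by move=> /andP[h0 h1] s0; rewrite exprn_gt0//= exprn_ilt1// ?ltW// -lt0n.
Qed.

Lemma continuous_saddle_amp S rho : 0 < rho < 1 -> all (fun s => 0 < s)%N S ->
  continuous (saddle_amp S rho).
Proof.
move=> rho01; elim: S => [_ t|s S IH /= /andP[s0 S0] t].
  by rewrite /saddle_amp; under eq_fun do rewrite big_nil; exact: cvg_cst.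
have rs := expr_pow_itv rho01 s0.
rewrite /saddle_amp; under eq_fun do rewrite big_cons.
apply: cvgM; last exact: IH.
apply: cvgV.
  by rewrite gt_eqF// sqrtr_gt0 (lt_le_trans _ (geo_var_ge1 _ rs)).
have cg := continuous_compose (@continuous_scale s%:R) (@continuous_geo_var _ (rho ^+ s)).
exact: (continuous_compose cg (@sqrt_continuous R)).
Qed.

Lemma continuous_saddle_phase S rho : 0 < rho < 1 -> all (fun s => 0 < s)%N S ->
  continuous (saddle_phase S rho).
Proof.
move=> rho01; elim: S => [_ t|s S IH /= /andP[s0 S0] t].
  by rewrite /saddle_phase; under eq_fun do rewrite big_nil; exact: cvg_cst.
have rs := expr_pow_itv rho01 s0.
rewrite /saddle_phase; under eq_fun do rewrite big_cons.
apply: cvgD; last exact: IH.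
exact: (continuous_compose (@continuous_scale _) (continuous_geo_arg rs)).
Qed.

Lemma saddle_amp_itv S rho t : 0 < rho < 1 -> all (fun s => 0 < s)%N S ->
  0 < saddle_amp S rho t <= 1.
Proof.
move=> rho01; elim: S => [_|s S IH /= /andP[s0 S0]].
  by rewrite /saddle_amp big_nil ltr01 lexx.
have /andP[A0 A1] := IH S0.
have g1 := geo_var_ge1 (s%:R * t) (expr_pow_itv rho01 s0).
have q1 : 1 <= Num.sqrt (geo_var (rho ^+ s) (s%:R * t)) by rewrite -[leLHS]sqrtr1 ler_wsqrtr.
rewrite /saddle_amp big_cons -/(saddle_amp S rho t) mulr_gt0//=; last first.
  by rewrite invr_gt0 (lt_le_trans ltr01 q1).
have q0 := lt_le_trans ltr01 q1.
by apply: mulr_ile1 => //; rewrite ?invr_ge0 ?invf_le1// ltW.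
Qed.

Lemma integral_0pi_cst (c : R) : \int0pi (fun=> c) = c * pi.
Proof.
rewrite Rintegral_cst//; congr (_ * _).
have mu_pi : @lebesgue_measure R `[0%R, pi]%classic = pi%:E.
  by rewrite lebesgue_measure_itv/= lte_fin pi_gt0 -EFinD/= subr0.
exact: (congr1 fine mu_pi).
Qed.

(* Up to normalisation, the [m]-th Fourier coefficient of [t |-> \prod_(s <- S) (1 - (rho e^{-it})^s)^-1],
   folded to [[0, pi]] by symmetry. *)
Definition coef_integral (S : seq nat) rho (m : int) : R :=
  \int0pi (fun t => saddle_amp S rho t * cos (m%:~R * t - saddle_phase S rho t)).

Lemma continuous_coef_integrand S rho (c : R) : 0 < rho < 1 -> all (fun s => 0 < s)%N S ->
  continuous (fun t => saddle_amp S rho t * cos (c * t - saddle_phase S rho t)).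
Proof.
move=> rho01 S0 t; apply: cvgM; first exact: continuous_saddle_amp.
have cp : continuous (fun t => c * t - saddle_phase S rho t).
  move=> x; apply: cvgB; [exact: continuous_scale|exact: continuous_saddle_phase].
exact: (continuous_compose cp (@continuous_cos R)).
Qed.

(** Multiplying by [1 - (rho e^{-it})^s] clears the factor of [s], and the multiplication by
    [e^{-ist}] lowers the frequency by [s]. The identity already holds between the integrands. *)
Lemma coef_integral_rec (s : nat) S rho (m : int) :
  0 < rho < 1 -> (0 < s)%N -> all (fun s => 0 < s)%N S ->
  coef_integral (s :: S) rho m =
  rho ^+ s * coef_integral (s :: S) rho (m - s%:Z) + (1 - rho ^+ s) * coef_integral S rho m.
Proof.
move=> rho01 s0 S0; have sS0 : all (fun s => 0 < s)%N (s :: S) by rewrite /= s0.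
have mI : measurable (`[0%R, pi]%classic : set R) by [].
have c1 (c : R) := continuous_coef_integrand (c := c) rho01 sS0.
have c2 (c : R) := continuous_coef_integrand (c := c) rho01 S0.
rewrite /coef_integral -RintegralZl//; last exact/integrable_0pi/c1.
rewrite -RintegralZl//; last exact/integrable_0pi/c2.
rewrite -RintegralD//; last 2 first.
- apply: integrable_0pi => t; apply: cvgM; [exact: cvg_cst|exact: c1].
- apply: integrable_0pi => t; apply: cvgM; [exact: cvg_cst|exact: c2].
apply: eq_Rintegral => t _.
have := @geo_factor_rotation R (rho ^+ s) (s%:R * t) (m%:~R * t - saddle_phase S rho t)
  (expr_pow_itv rho01 s0).
rewrite /saddle_amp /saddle_phase !big_cons -/(saddle_amp S rho t) -/(saddle_phase S rho t).
set q := (Num.sqrt _)^-1; set g := geo_arg _ _ => h.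
rewrite intrB -pmulrn mulrBl.
rewrite [X in _ = _ + X]mulrCA -h.
have -> : m%:~R * t - s%:R * t - (g + saddle_phase S rho t) =
  m%:~R * t - saddle_phase S rho t - g - s%:R * t by ring.
have -> : m%:~R * t - (g + saddle_phase S rho t) =
  m%:~R * t - saddle_phase S rho t - g by ring.
by ring.
Qed.

Lemma coef_integral_le S rho m : 0 < rho < 1 -> all (fun s => 0 < s)%N S ->
  `|coef_integral S rho m| <= pi.
Proof.
move=> rho01 S0.
have c2 := continuous_coef_integrand (c := m%:~R) rho01 S0.
have mI : measurable (`[0%R, pi]%classic : set R) by [].
rewrite /coef_integral; apply: le_trans; first by apply: le_normr_Rintegral => //; exact: (integrable_0pi c2).
rewrite -[leRHS]mul1r -integral_0pi_cst.
apply: le_Rintegral => //; first exact/integrable_norm/integrable_0pi.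
  by apply: integrable_0pi => t; exact: cvg_cst.
move=> t _; rewrite normrM mulr_ile1//; last by rewrite cos_max.
by have /andP[A0 A1] := saddle_amp_itv t rho01 S0; rewrite ger0_norm// ltW.
Qed.

(* The recursion relates [m] to [m - s], so iterating it multiplies by an arbitrarily high power of [rho]. *)
Lemma coef_integral_neg S rho m : 0 < rho < 1 -> all (fun s => 0 < s)%N S ->
  m < 0 -> coef_integral S rho m = 0.
Proof.
move=> rho01; elim: S m => [m _ m0|s S IH m /= /andP[s0 S0] m0].
  rewrite -(@integral_0pi_cos m) ?lt_eqF// /coef_integral.
  by apply: eq_Rintegral => t _; rewrite /saddle_amp /saddle_phase !big_nil mul1r subr0.
have sS0 : all (fun s => 0 < s)%N (s :: S) by rewrite /= s0.
have iterE j : coef_integral (s :: S) rho m =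
    rho ^+ (s * j) * coef_integral (s :: S) rho (m - (s * j)%N%:Z).
  elim: j => [|j IHj]; first by rewrite muln0 expr0 mul1r subr0.
  rewrite IHj coef_integral_rec// IH ?mulr0 ?addr0//; last by lia.
  rewrite mulrA -exprD mulnS addnC; congr (_ * coef_integral _ _ _); lia.
have /andP[r0 r1] := expr_pow_itv rho01 s0.
apply/eqP; rewrite -normr_le0.
have cv : (fun j => pi * (rho ^+ s) ^+ j) @ \oo --> (0 : R).
  rewrite -[X in _ --> X](mulr0 pi); apply: cvgM; first exact: cvg_cst.
  by apply: cvg_expr; rewrite ger0_norm// ltW.
apply: (cvgr_to_ge cv); apply: nearW => j.
have rj0 := exprn_ge0 j (ltW r0).
by rewrite (iterE j) normrM mulrC exprM (ger0_norm rj0) ler_wpM2r// coef_integral_le.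
Qed.

(** Induction on [S] and [n] along the two matching recursions takes the place of Cauchy's formula;
    the vanishing of negative frequencies corresponds to the case [n < s] of [part_count_rec]. *)
Lemma coef_integral_part_count S rho (n : nat) :
  0 < rho < 1 -> all (fun s => 0 < s)%N S ->
  coef_integral S rho n%:Z =
  pi * rho ^+ n * \prod_(s <- S) (1 - rho ^+ s) * (part_count S n)%:R.
Proof.
move=> rho01; elim: S n => [n _|s S IH n /[dup] sS0 /andP[s0 S0]].
  rewrite big_nil mulr1 /coef_integral.
  under eq_Rintegral => t _ do rewrite /saddle_amp /saddle_phase !big_nil mul1r subr0.
  case: n => [|n]; last by rewrite integral_0pi_cos// mulr0.
  under eq_Rintegral => t _ do rewrite mul0r cos0.
  by rewrite integral_0pi_cst expr0 mul1r !mulr1.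
rewrite big_cons; elim/ltn_ind: n => n IHn.
rewrite part_count_rec// coef_integral_rec// IH//.
case: leqP => sn; last by rewrite coef_integral_neg ?mulr0 ?add0r ?addn0//; [ring|lia].
have -> : n%:Z - s%:Z = (n - s)%N%:Z by lia.
rewrite IHn ?ltn_subrL ?s0 ?(leq_trans s0)//.
have -> : rho ^+ n = rho ^+ s * rho ^+ (n - s) by rewrite -exprD subnKC.
by rewrite natrD; ring.
Qed.

End coefficient_integral.


(** * Comparison with Gaussian integrals *)

Section gaussian_comparison.
Variable R : realType.
Local Open Scope classical_set_scope.
Local Open Scope ring_scope.
Local Notation mu := (@lebesgue_measure R).
Implicit Types (b c t : R).

Definition gaussian b t : R := expR (- (b * t ^+ 2)).

Lemma continuous_gaussian b : continuous (gaussian b).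
Proof.
apply: (@continuous_compose R (fun t => - (b * t ^+ 2)) expR); last exact: continuous_expR.
move=> t; apply: cvgN; apply: cvgM; first exact: cvg_cst.
exact: exprn_continuous.
Qed.

Lemma gaussian_normalE b : 0 < b ->
  gaussian b = fun x => Num.sqrt (pi / b) * normal_pdf 0 (Num.sqrt (2 * b)^-1) x.
Proof.
move=> b0; apply/funext => x.
have s0 : Num.sqrt (2 * b)^-1 != 0 by rewrite gt_eqF// sqrtr_gt0 invr_gt0 mulr_gt0.
have sE : Num.sqrt (2 * b)^-1 ^+ 2 = (2 * b)^-1.
  by rewrite sqr_sqrtr// invr_ge0 mulr_ge0// ltW.
rewrite normal_pdfE// /normal_peak /normal_fun sE.
have -> : (2 * b)^-1 * pi *+ 2 = pi / b by field; lra.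
rewrite mulrA divff ?mul1r; last by rewrite gt_eqF// sqrtr_gt0 divr_gt0// pi_gt0.
by rewrite /gaussian subr0; congr expR; field; lra.
Qed.

Lemma integrable_gaussian b (D : set R) : 0 < b -> measurable D ->
  mu.-integrable D (EFin \o gaussian b).
Proof.
move=> b0 mD; apply: (@integrableS _ _ _ mu setT) => //.
rewrite gaussian_normalE//.
have := integrableZl measurableT (Num.sqrt (pi / b)) (integrable_normal_pdf 0 (Num.sqrt (2 * b)^-1)).
by apply: eq_integrable.
Qed.

Lemma integral_gaussian b : 0 < b ->
  \int[mu]_(t in `[0, +oo[) gaussian b t = Num.sqrt (pi / b) / 2.
Proof.
move=> b0.
have iT : (\int[mu]_t (gaussian b t)%:E = (Num.sqrt (pi / b))%:E)%E.
  rewrite gaussian_normalE//.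
  under eq_integral do rewrite EFinM.
  rewrite integralZl//; last exact: integrable_normal_pdf.
  by rewrite integral_normal_pdf// mule1.
move: iT; rewrite ge0_symfun_integralT//; last 3 first.
- by move=> x; exact: expR_ge0.
- exact: continuous_gaussian.
- by move=> x; rewrite /gaussian /= sqrrN.
have -> : [set x : R | 0 <= x] = `[0, +oo[%classic.
  by apply/seteqP; split => x /=; rewrite in_itv/= andbT.
have fi : (\int[mu]_(x in `[0%R, +oo[) (gaussian b x)%:E \is a fin_num)%E.
  by apply: integrable_fin_num => //; exact: integrable_gaussian.
rewrite /Rintegral; move: fi.
case: (\int[mu]_(x in _) _)%E => // r _ /=.
by rewrite -EFinM => -[] /= <-; lra.
Qed.

(** Dominating the pointwise error by Gaussians on the whole half line gives every error integral in
    closed form, so that the domain of integration is never split. *)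
Lemma gaussian_comparison (f : R -> R) (a b c1 b1 c2 b2 c3 b3 : R) :
  0 < b -> 0 < b1 -> 0 < b2 -> 0 < b3 ->
  mu.-integrable `[0, +oo[ (EFin \o f) ->
  (forall t, 0 <= t -> `|f t - a * gaussian b t| <=
     c1 * gaussian b1 t + c2 * gaussian b2 t + c3 * gaussian b3 t) ->
  `|\int[mu]_(t in `[0, +oo[) f t - a * (Num.sqrt (pi / b) / 2)| <=
    c1 * (Num.sqrt (pi / b1) / 2) + c2 * (Num.sqrt (pi / b2) / 2)
      + c3 * (Num.sqrt (pi / b3) / 2).
Proof.
move=> b0 b10 b20 b30 intf le_f.
have ig x c : 0 < x -> mu.-integrable `[0, +oo[ (EFin \o (fun t => c * gaussian x t)).
  move=> x0; have ix : mu.-integrable `[0, +oo[ (EFin \o gaussian x).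
    exact: integrable_gaussian.
  by apply: eq_integrable (integrableZl _ c ix).
have i12 : mu.-integrable `[0, +oo[ (EFin \o (fun t => c1 * gaussian b1 t + c2 * gaussian b2 t)).
  by apply: eq_integrable (integrableD _ (ig _ c1 b10) (ig _ c2 b20)).
have i123 : mu.-integrable `[0, +oo[
    (EFin \o (fun t => c1 * gaussian b1 t + c2 * gaussian b2 t + c3 * gaussian b3 t)).
  by apply: eq_integrable (integrableD _ i12 (ig _ c3 b30)).
have idf : mu.-integrable `[0, +oo[ (EFin \o (fun t => f t - a * gaussian b t)).
  by apply: eq_integrable (integrableB _ intf (ig _ a b0)).
rewrite -!integral_gaussian//.
rewrite -!RintegralZl//; try exact: integrable_gaussian.
rewrite -RintegralB//; last exact: ig.
rewrite -!RintegralD//; try exact: ig.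
apply: le_trans; first exact: le_normr_Rintegral.
apply: le_Rintegral => //; first exact: integrable_norm.
by move=> t /=; rewrite in_itv/= andbT; exact: le_f.
Qed.

End gaussian_comparison.

(** * Expansion at the saddle point *)

Section elementary_inequalities.
Variable R : realType.
Implicit Types (r t u x y : R).

(** Monotonicity from the mean value theorem. It serves to integrate one trigonometric inequality
    into the next. *)
Lemma ge0_of_derive (f df : R -> R) x : (forall y, is_derive y 1 f (df y)) ->
  (forall y, 0 <= y -> 0 <= df y) -> 0 <= x -> f 0 <= f x.
Proof.
move=> fd df0; rewrite le_eqVlt => /predU1P[<-//|x0].
have cf : continuous f.
  by move=> y; apply/differentiable_continuous/derivable1_diffP; have [] := fd y.
have [c] := MVT_segment (ltW x0) (fun y _ => fd y) (continuous_subspaceT cf).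
rewrite in_itv/= => /andP[c0 _] h; by rewrite -subr_ge0 h subr0 mulr_ge0 ?df0 ?(ltW x0).
Qed.

Lemma is_derive_monom (c : R) (n : nat) x :
  is_derive x 1 (fun y : R => c * y ^+ n.+1) (c * (n.+1%:R * x ^+ n)).
Proof.
have -> : (fun y : R => c * y ^+ n.+1) = c *: ((id : R -> R) ^+ n.+1).
  by apply/funext => y; rewrite !fctE.
by apply: is_derive_eq; rewrite /GRing.scale /= mulr1.
Qed.

Lemma sin_le_id u : 0 <= u -> sin u <= u.
Proof.
move=> u0; rewrite -subr_ge0.
have := @ge0_of_derive (fun x => x - sin x) (fun x => 1 - cos x) u _ _ u0.
rewrite sin0 subr0; apply => y *.
by rewrite subr_ge0 cos_le1.
Qed.

Lemma cos_ge_quadratic u : 0 <= u -> 1 - u ^+ 2 / 2 <= cos u.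
Proof.
move=> u0; rewrite -subr_ge0.
have := @ge0_of_derive (fun x => cos x + 2^-1 * x ^+ 2) (fun x => x - sin x) u _ _ u0.
rewrite cos0 expr0n /= mulr0 addr0 => h; have : 1 <= cos u + 2^-1 * u ^+ 2; last by lra.
apply: h => y *; last by rewrite subr_ge0 sin_le_id.
have := is_deriveD (is_derive_cos y) (is_derive_monom 2^-1 1 y).
by move=> h; apply: (is_derive_eq h); lra.
Qed.

Lemma sin_ge_cubic u : 0 <= u -> u - u ^+ 3 / 6 <= sin u.
Proof.
move=> u0; rewrite -subr_ge0.
have := @ge0_of_derive (fun x => sin x - x + 6^-1 * x ^+ 3)
  (fun x => cos x - (1 - x ^+ 2 / 2)) u _ _ u0.
rewrite sin0 expr0n /= mulr0 subrr addr0 => h.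
have : 0 <= sin u - u + 6^-1 * u ^+ 3; last by lra.
apply: h => y *; last by rewrite subr_ge0 cos_ge_quadratic.
have h := is_deriveD (is_deriveB (is_derive_sin y) (is_derive_id y 1)) (is_derive_monom 6^-1 2 y).
by apply: (is_derive_eq h); lra.
Qed.

Lemma norm_sin_le x : `|sin x| <= `|x|.
Proof.
wlog x0 : x / 0 <= x.
  move=> h; case: (leP 0 x) => [/h//|x0].
  by have := h (- x); rewrite sinN !normrN oppr_ge0; apply; exact: ltW.
rewrite (ger0_norm x0) ler_norml sin_le_id// andbT.
case: (leP x 1) => x1; last by rewrite (le_trans _ (sin_geN1 x))// lerN2 ltW.
by have := sin_ge_cubic x0; nra.
Qed.

Lemma cos_lipschitz x y : `|cos x - cos y| <= `|x - y|.
Proof.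
have key (a b : R) : `|cos (a + b) - cos (a - b)| <= `|a + b - (a - b)|.
  rewrite cosD cosB.
  have -> : cos a * cos b - sin a * sin b - (cos a * cos b + sin a * sin b) =
    (- 2) * (sin a * sin b) by lra.
  have -> : a + b - (a - b) = 2 * b by lra.
  rewrite !normrM normrN (@ger0_norm _ 2)// ler_pM2l//.
  by apply: le_trans (norm_sin_le b); rewrite ler_piMl// sin_max.
have := key ((x + y) / 2) ((x - y) / 2).
have -> : (x + y) / 2 + (x - y) / 2 = x by lra.
by have -> : (x + y) / 2 - (x - y) / 2 = y by lra.
Qed.

Lemma norm_cos_sub1 x : `|cos x - 1| <= `|x|.
Proof. by have := cos_lipschitz x 0; rewrite cos0 subr0. Qed.

Lemma exp_sub_le (x y : R) : 0 <= x -> 0 <= y -> `|expR (- x) - expR (- y)| <= `|x - y|.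
Proof.
wlog xy : x y / x <= y.
  by move=> h x0 y0; case: (leP x y) => [/h//|/ltW /h]; [exact|rewrite distrC (distrC x); exact].
move=> x0 y0; rewrite ger0_norm; last by rewrite subr_ge0 ler_expR lerN2.
rewrite distrC ger0_norm ?subr_ge0//.
have e1 : expR (- x) <= 1 by rewrite expR_le1 oppr_le0.
have e0 := expR_gt0 (- x).
have -> : expR (- y) = expR (- x) * expR (- (y - x)) by rewrite -expRD; congr expR; lra.
have := expR_ge1Dx (- (y - x)); nra.
Qed.

Lemma expR_quadratic_le x : 0 <= x <= 1 / 2 -> 0 <= expR x - 1 - x <= 2 * x ^+ 2.
Proof.
move=> /andP[x0 x1]; have h1 := expR_ge1Dx x; have h2 := expR_ge1Dx (- x).
have := expRxMexpNx_1 x; have := expR_gt0 x; rewrite /= => h3 h4.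
apply/andP; split; first by lra.
have : expR x * (1 - x) <= 1 by nra.
have -> : expR x = (expR x - 1 - x) + 1 + x by lra.
by nra.
Qed.

Lemma ln1D_ge y : 0 <= y -> y - y ^+ 2 <= ln (1 + y).
Proof.
move=> y0; have y1 : 0 < 1 + y by lra.
have : 1 - (1 + y)^-1 <= ln (1 + y).
  have := @le_ln1Dx R ((1 + y)^-1 - 1).
  have -> : 1 + ((1 + y)^-1 - 1) = (1 + y)^-1 by lra.
  rewrite lnV ?posrE// => h.
  have : - 1 < (1 + y)^-1 - 1 by rewrite ltrBDl subrr invr_gt0.
  by move=> /h; lra.
apply: le_trans.
have -> : 1 - (1 + y)^-1 = y / (1 + y) by field; lra.
by rewrite ler_pdivlMr//; nra.
Qed.

End elementary_inequalities.

Section local_expansion.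
Variable R : realType.
Implicit Types (r rho t u x : R) (S : seq nat).

(** The derivative is the real part of [z / (1 - z)] for [z = r e^{-iu}]. *)
Lemma is_derive_geo_arg r u : 0 < r < 1 ->
  is_derive u 1 (geo_arg r) ((r * cos u - r ^+ 2) / (1 - 2 * r * cos u + r ^+ 2)).
Proof.
move=> r01; have d0 := one_minus_rcos_gt0 u r01; move: (r01) => /andP[r0 r1].
have hn : is_derive u 1 (r *: @sin R) (r * cos u).
  by apply: is_derive_eq.
have hd : is_derive u 1 (cst 1 - r *: @cos R) (r * sin u).
  by apply: is_derive_eq; rewrite /GRing.scale /=; lra.
have hv := @is_deriveV _ _ _ _ _ (_ : (cst 1 - r *: @cos R) u != 0) hd.
have {hv}hv := hv (lt0r_neq0 d0).
have := @is_derive1_comp _ (@atan R) _ u _ _ (is_derive1_atan _) (is_deriveM hn hv).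
move=> h; apply: (is_derive_eq h).
rewrite !fctE /= /GRing.scale /=.
set c := cos u; have s2 : sin u ^+ 2 = 1 - c ^+ 2 by have := cos2Dsin2 u; rewrite -/c; lra.
set s := sin u in s2 *.
have D0 : 0 < 1 - 2 * r * c + r ^+ 2.
  have -> : 1 - 2 * r * c + r ^+ 2 = (1 - r * c) ^+ 2 + (r * s) ^+ 2.
    by rewrite exprMn s2; ring.
  by rewrite ltr_wpDr ?sqr_ge0// exprn_gt0.
have d0' : 1 - r * c != 0 by rewrite gt_eqF.
have -> : 1 + (r * s * (1 - r * c)^-1) ^+ 2 = (1 - 2 * r * c + r ^+ 2) / (1 - r * c) ^+ 2.
  by rewrite exprMn exprMn s2; field.
have -> : r * s * (- (1 - r * c) ^- 2 * (r * s)) + (1 - r * c)^-1 * (r * c) =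
   (r * c * (1 - r * c) - r ^+ 2 * s ^+ 2) / (1 - r * c) ^+ 2 by field.
by rewrite s2; field; rewrite d0' gt_eqF.
Qed.

Lemma geo_arg0 r : geo_arg r 0 = 0.
Proof. by rewrite /geo_arg sin0 mulr0 mul0r atan0. Qed.

(** The derivative of the difference is [r (1 + r) (1 - cos u) / ((1 - r) |1 - z|^2)]. It is
    nonnegative, and by [1 - cos u <= u^2 / 2] and [|1 - z| >= 1 - r] it is at most the derivative
    of the cubic bound. *)
Lemma geo_arg_linear r u : 0 < r < 1 -> 0 <= u ->
  0 <= r / (1 - r) * u - geo_arg r u <= r / (1 - r) ^+ 3 * u ^+ 3.
Proof.
move=> r01 u0; move: (r01) => /andP[r0 r1].
have D0 y : 0 < 1 - 2 * r * cos y + r ^+ 2.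
  have := cos_le1 y; nra.
pose df y := r / (1 - r) - (r * cos y - r ^+ 2) / (1 - 2 * r * cos y + r ^+ 2).
have dfE y : df y = r * (1 + r) * (1 - cos y) / ((1 - r) * (1 - 2 * r * cos y + r ^+ 2)).
  by rewrite /df; field; rewrite !gt_eqF// subr_gt0.
have df0 y : 0 <= df y.
  have c1 := cos_le1 y; rewrite dfE; apply: divr_ge0.
    by apply: mulr_ge0; [apply: mulr_ge0; lra|lra].
  by apply: mulr_ge0; [lra|exact: ltW].
have df1 y : 0 <= y -> df y <= r / (1 - r) ^+ 3 * (3 * y ^+ 2).
  move=> y0; rewrite dfE.
  have c1 := cos_ge_quadratic y0; have c2 := cos_le1 y.
  have -> : r / (1 - r) ^+ 3 * (3 * y ^+ 2) = r * (3 * y ^+ 2) / (1 - r) ^+ 3.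
    by rewrite mulrAC.
  apply: ler_pM => //.
  - by apply: mulr_ge0; [apply: mulr_ge0; lra|lra].
  - by rewrite invr_ge0; apply: mulr_ge0; [lra|exact: ltW].
  - rewrite -mulrA ler_pM2l//.
    have : (1 + r) * (1 - cos y) <= 2 * (y ^+ 2 / 2) by apply: ler_pM; lra.
    by have := sqr_ge0 y; lra.
  - rewrite lef_pV2 ?posrE ?exprn_gt0 ?mulr_gt0 ?subr_gt0//.
    rewrite exprS ler_pM2l ?subr_gt0//.
    have -> : (1 - r) ^+ 2 = 1 - 2 * r + r ^+ 2 by ring.
    by nra.
have hd (y : R) : is_derive y 1 (fun y : R => r / (1 - r) * y ^+ 1 - geo_arg r y) (df y).
  have := is_deriveB (is_derive_monom (r / (1 - r)) 0 y) (is_derive_geo_arg y r01).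
  by move=> h; apply: (is_derive_eq h); rewrite /df expr0 !mulr1.
have hd2 (y : R) : is_derive y 1 (fun y : R => r / (1 - r) ^+ 3 * y ^+ 3 -
    (r / (1 - r) * y ^+ 1 - geo_arg r y)) (r / (1 - r) ^+ 3 * (3 * y ^+ 2) - df y).
  have := is_deriveB (is_derive_monom (r / (1 - r) ^+ 3) 2 y) (hd y).
  by move=> h; apply: (is_derive_eq h).
have := @ge0_of_derive R _ _ u hd (fun y _ => df0 y) u0.
rewrite geo_arg0 expr1 mulr0 subr0 expr1 => -> /=.
have := @ge0_of_derive R _ _ u hd2 _ u0.
rewrite geo_arg0 expr0n expr1 /= !mulr0 !subr0 expr1 subr_ge0; apply.
by move=> y y0; rewrite subr_ge0 df1.
Qed.

(** Write [geo_var r u = 1 + y]. Then [ln (1 + y)] lies between [y - y^2] and [y], and [y] differs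
    from [b u^2] by at most [b u^4 / 12]; both [b] and [b^2] are at most [r / (1 - r)^4]. *)
Lemma ln_geo_var_quadratic r u : 0 < r < 1 -> 0 <= u ->
  `|ln (geo_var r u) / 2 - r / (1 - r) ^+ 2 * u ^+ 2 / 2| <= r / (1 - r) ^+ 4 * u ^+ 4.
Proof.
move=> r01 u0; move: (r01) => /andP[r0 r1].
set b := r / (1 - r) ^+ 2.
have b0 : 0 <= b by rewrite /b divr_ge0 ?sqr_ge0// ltW.
have u20 : 0 <= u / 2 by lra.
have s1 : `|sin (u / 2)| <= u / 2 by rewrite -[leRHS]ger0_norm// norm_sin_le.
have s2 := sin_ge_cubic u20.
set q := sin (u / 2) ^+ 2.
have q0 : 0 <= q by rewrite sqr_ge0.
have q1 : q <= (u / 2) ^+ 2 by rewrite -[q]ger0_norm// normrX lerXn2r ?nnegrE.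
have q2 : (u / 2) ^+ 2 - (u / 2) ^+ 4 / 3 <= q.
  (* Up to 3 the cubic lower bound of the sine is nonnegative and may be squared; beyond 3 the left
     side is negative. *)
  case: (leP ((u / 2) ^+ 2) 3) => h.
    have h2 : 0 <= u / 2 - (u / 2) ^+ 3 / 6.
      by rewrite exprS; nra.
    have : (u / 2 - (u / 2) ^+ 3 / 6) ^+ 2 <= q by rewrite lerXn2r ?nnegrE// (le_trans h2).
    apply: le_trans; have := sqr_ge0 ((u / 2) ^+ 3 / 6); nra.
  apply: le_trans q0.
  have -> : (u / 2) ^+ 4 = (u / 2) ^+ 2 * (u / 2) ^+ 2 by rewrite -exprD.
  by nra.
pose y := 4 * b * q.
have y0 : 0 <= y by rewrite /y mulr_ge0// mulr_ge0.
have gE : geo_var r u = 1 + y by [].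
rewrite gE.
have l1 : ln (1 + y) <= y by apply: le_ln1Dx; lra.
have l2 := ln1D_ge y0.
have by1 : b <= r / (1 - r) ^+ 4.
  rewrite ler_pM2l// lef_pV2 ?posrE ?exprn_gt0 ?subr_gt0//.
  by rewrite ler_wiXn2l// ?subr_ge0 ?ltW//; lra.
have by2 : b ^+ 2 <= r / (1 - r) ^+ 4.
  rewrite /b expr_div_n -exprM ler_pM2r ?invr_gt0 ?exprn_gt0 ?subr_gt0//.
  by rewrite expr2; nra.
have yu : y <= b * u ^+ 2 by rewrite /y; nra.
have yl : b * u ^+ 2 - b * u ^+ 4 / 12 <= y.
  have -> : b * u ^+ 2 - b * u ^+ 4 / 12 = 4 * b * ((u / 2) ^+ 2 - (u / 2) ^+ 4 / 3).
    by rewrite !expr_div_n; lra.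
  by rewrite /y ler_wpM2l// mulr_ge0.
have y2 : y ^+ 2 <= b ^+ 2 * u ^+ 4.
  have -> : b ^+ 2 * u ^+ 4 = (b * u ^+ 2) ^+ 2 by ring.
  by rewrite lerXn2r ?nnegrE// mulr_ge0// sqr_ge0.
have u4 : 0 <= u ^+ 4 by rewrite exprn_ge0.
have h1 : b * u ^+ 4 <= r / (1 - r) ^+ 4 * u ^+ 4 by rewrite ler_wpM2r.
have h2 : b ^+ 2 * u ^+ 4 <= r / (1 - r) ^+ 4 * u ^+ 4 by rewrite ler_wpM2r.
have h3 : 0 <= r / (1 - r) ^+ 4 * u ^+ 4 by rewrite (le_trans _ h1)// mulr_ge0.
move: h1 h2 h3; set w := r / (1 - r) ^+ 4 * u ^+ 4; move: yu yl y2 l1 l2; set z := b * u ^+ 2.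
move: (ln _) (b * u ^+ 4) (b ^+ 2 * u ^+ 4) w z => l v v2 w z *.
by rewrite ler_norml; apply/andP; split; lra.
Qed.

(** For [j = 1] and [j = 2] these are the truncations of [rho Phi'(rho)] and [Phi_(2)(rho)]. For
    [j = 3] and [j = 4] they bound the cubic phase error and the quartic amplitude error. *)
Definition saddle_moment S rho (j : nat) : R :=
  \sum_(s <- S) rho ^+ s / (1 - rho ^+ s) ^+ j * s%:R ^+ j.

Lemma saddle_moment_ge0 S rho j : 0 < rho < 1 -> 0 <= saddle_moment S rho j.
Proof.
move=> /andP[r0 r1]; apply: sumr_ge0 => s _.
apply: mulr_ge0; last by rewrite exprn_ge0.
apply: divr_ge0; first by rewrite exprn_ge0// ltW.
by rewrite exprn_ge0// subr_ge0 exprn_ile1// ltW.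
Qed.

Lemma saddle_phase_linear S rho t : 0 < rho < 1 -> all (fun s => 0 < s)%N S -> 0 <= t ->
  0 <= saddle_moment S rho 1 * t - saddle_phase S rho t <= saddle_moment S rho 3 * t ^+ 3.
Proof.
move=> rho01 + t0; elim: S => [_|s S IH /= /andP[s0 S0]].
  by rewrite /saddle_moment /saddle_phase !big_nil !mul0r subrr lexx.
have /andP[h1 h2] := IH S0.
have st0 : 0 <= s%:R * t by rewrite mulr_ge0.
have /andP[g1 g2] := geo_arg_linear (expr_pow_itv rho01 s0) st0.
rewrite /saddle_moment /saddle_phase !big_cons -/(saddle_moment S rho 1)
  -/(saddle_moment S rho 3) -/(saddle_phase S rho t).
rewrite exprMn in g2.
by apply/andP; split; lra.
Qed.

Lemma saddle_amp_expR S rho t : 0 < rho < 1 -> all (fun s => 0 < s)%N S ->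
  saddle_amp S rho t = expR (- \sum_(s <- S) ln (geo_var (rho ^+ s) (s%:R * t)) / 2).
Proof.
move=> rho01; elim: S => [_|s S IH /= /andP[s0 S0]].
  by rewrite /saddle_amp !big_nil oppr0 expR0.
rewrite /saddle_amp !big_cons -/(saddle_amp S rho t) IH// opprD expRD; congr (_ * _).
have g0 := lt_le_trans ltr01 (geo_var_ge1 (s%:R * t) (expr_pow_itv rho01 s0)).
rewrite expRN; congr (_^-1).
rewrite -powR12_sqrt ?ltW// /powR gt_eqF//; congr expR; lra.
Qed.

(** Both sides are exponentials of nonpositive numbers, where the exponential is 1-Lipschitz; it
    remains to add up the quartic errors of the factors. *)
Lemma saddle_amp_gaussian S rho t : 0 < rho < 1 -> all (fun s => 0 < s)%N S -> 0 <= t ->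
  `|saddle_amp S rho t - gaussian (saddle_moment S rho 2 / 2) t| <=
  saddle_moment S rho 4 * t ^+ 4.
Proof.
move=> rho01 S0 t0; rewrite saddle_amp_expR// /gaussian.
apply: le_trans.
  apply: exp_sub_le.
    rewrite big_seq sumr_ge0// => s sS; rewrite divr_ge0// ln_ge0//.
    by rewrite geo_var_ge1// expr_pow_itv// (allP S0).
  by rewrite mulr_ge0 ?sqr_ge0// divr_ge0// saddle_moment_ge0.
elim: S S0 => [_|s S IH /= /andP[s0 S0]].
  by rewrite /saddle_moment !big_nil !mul0r subr0 normr0.
rewrite /saddle_moment !big_cons -/(saddle_moment S rho 2) -/(saddle_moment S rho 4).
have st0 : 0 <= s%:R * t by rewrite mulr_ge0.
have h := ln_geo_var_quadratic (expr_pow_itv rho01 s0) st0.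
have := ler_normD (ln (geo_var (rho ^+ s) (s%:R * t)) / 2 -
   rho ^+ s / (1 - rho ^+ s) ^+ 2 * (s%:R * t) ^+ 2 / 2)
  (\sum_(j <- S) ln (geo_var (rho ^+ j) (j%:R * t)) / 2 - saddle_moment S rho 2 / 2 * t ^+ 2).
rewrite -[X in `|X| <= _]addrACA -opprD => h2.
have := le_trans h2 (lerD h (IH S0)).
rewrite !exprMn => h3; apply: le_trans (le_trans h3 _).
  by rewrite le_eqVlt; apply/orP; left; apply/eqP; congr `| _ - _ |; ring.
by rewrite le_eqVlt; apply/orP; left; apply/eqP; ring.
Qed.

(** The near cancellation of the linear phase gives [|psi| <= t + saddle_moment S rho 3 * t^3]. The
    bracket is compared with [a] in three steps: [e^a - 1 - a] is quadratic, [cos - 1] comes with a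
    factor [a], and the shift of the cosine by [t] costs [t]. The last one requires arcs much
    shorter than [a]. *)
Lemma saddle_integrand_gaussian S rho (a : R) (n : nat) t :
  rho = expR (- a) -> 0 < a <= 1 / 2 -> all (fun s => 0 < s)%N S ->
  `|n%:R - saddle_moment S rho 1| <= 1 -> 0 <= t ->
  `|saddle_amp S rho t * (rho^-1 * cos (n.+1%:R * t - saddle_phase S rho t)
       - cos (n%:R * t - saddle_phase S rho t))
    - a * gaussian (saddle_moment S rho 2 / 2) t| <=
  2 * a ^+ 2 + a * (2 * t + saddle_moment S rho 3 * t ^+ 3) + t
    + a * (saddle_moment S rho 4 * t ^+ 4).
Proof.
move=> rhoE /andP[a0 a1] S0 nM t0.
have rho01 : 0 < rho < 1 by rewrite rhoE expR_gt0 expR_lt1 oppr_lt0 a0.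
have hA := saddle_amp_gaussian rho01 S0 t0.
have /andP[A0 A1] := saddle_amp_itv t rho01 S0.
have /andP[p1 p2] := saddle_phase_linear rho01 S0 t0.
have -> : rho^-1 = expR a by rewrite rhoE expRN invrK.
have aI : 0 <= a <= 1 / 2 by rewrite (ltW a0).
have /andP[e1 e2] := expR_quadratic_le aI.
set psi := n%:R * t - saddle_phase S rho t.
have -> : n.+1%:R * t - saddle_phase S rho t = t + psi by rewrite /psi -natr1; ring.
have psi_le : `|psi| <= t + saddle_moment S rho 3 * t ^+ 3.
  have -> : psi = (n%:R - saddle_moment S rho 1) * t
      + (saddle_moment S rho 1 * t - saddle_phase S rho t) by rewrite /psi; ring.
  apply: le_trans (ler_normD _ _) _; apply: lerD.
    by rewrite normrM (ger0_norm t0) ler_piMl.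
  by rewrite ger0_norm.
set e := expR a in e1 e2 *.
pose Q := e * cos (t + psi) - cos psi.
have Q_le : `|Q - a| <= 2 * a ^+ 2 + a * (2 * t + saddle_moment S rho 3 * t ^+ 3) + t.
  have -> : Q - a = (e - 1 - a) * cos (t + psi) + a * (cos (t + psi) - 1)
     + (cos (t + psi) - cos psi) by rewrite /Q; ring.
  apply: le_trans (ler_normD _ _) _; apply: lerD; last first.
    by apply: le_trans (cos_lipschitz _ _) _; rewrite addrK ger0_norm.
  apply: le_trans (ler_normD _ _) _; rewrite !normrM; apply: lerD.
    by rewrite (ger0_norm e1) (le_trans _ e2)// ler_piMr// cos_max.
  rewrite (ger0_norm (ltW a0)) ler_pM2l// (le_trans (norm_cos_sub1 _))//.
  by rewrite (le_trans (ler_normD _ _))// (ger0_norm t0); lra.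
have -> : saddle_amp S rho t * (e * cos (t + psi) - cos psi) -
   a * gaussian (saddle_moment S rho 2 / 2) t =
   saddle_amp S rho t * (Q - a) + a * (saddle_amp S rho t - gaussian (saddle_moment S rho 2 / 2) t).
  by rewrite /Q; ring.
apply: le_trans (ler_normD _ _) _; rewrite !normrM; apply: lerD.
  by rewrite (ger0_norm (ltW A0)) (le_trans _ Q_le)// ler_piMl.
by rewrite (ger0_norm (ltW a0)) ler_pM2l.
Qed.

End local_expansion.

(** * Prime powers: moments and Chebyshev's bound *)

Section moment_bounds.
Variable R : realType.
Implicit Types (a Y t x : R).

Lemma expR_half_le2 : expR (1 / 2) <= 2 :> R.
Proof.
have := expRxMexpNx_1 (1 / 2 : R); have := expR_ge1Dx (- (1 / 2) : R).
have := expR_gt0 (1 / 2 : R); nra.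
Qed.

Lemma expR_opp1_ge : 1 / 4 <= expR (- 1) :> R.
Proof.
have h := expR_half_le2; have h0 := expR_gt0 (1 / 2 : R).
have -> : -1 = - (1 / 2 + 1 / 2) :> R by lra.
rewrite expRN expRD -[leLHS]invrK lef_pV2 ?posrE ?invr_gt0 ?mulr_gt0//; nra.
Qed.

(** The rate [x / 8] is chosen so that a fourth power costs [e^{x/2}], half of the decay [e^{-x}]
    available in the moments. *)
Lemma div_one_sub_exp_le x : 0 < x -> x / (1 - expR (- x)) <= 8 * expR (x / 8).
Proof.
move=> x0; have h1 := expR_ge1Dx x; have h2 := expR_ge1Dx (x / 8).
have e1 : expR (- x) < 1 by rewrite expR_lt1 oppr_lt0.
have h3 := expRxMexpNx_1 x; have h4 := expR_gt0 (- x).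
rewrite ler_pdivrMr ?subr_gt0//.
have h5 : x <= (1 + x) * (1 - expR (- x)) by nra.
by apply: le_trans h5 _; rewrite ler_pM2r ?subr_gt0//; lra.
Qed.

Lemma sum_exp_linear_le Y (M : nat) : 0 < Y ->
  \sum_(1 <= m < M) expR (- (m%:R / (2 * Y))) <= 2 * Y.
Proof.
move=> Y0; pose x := (2 * Y)^-1; have x0 : 0 < x by rewrite invr_gt0 mulr_gt0.
have h : \sum_(1 <= m < M) expR (- (m%:R / (2 * Y))) * (expR x - 1) <= 1.
  rewrite -[leRHS](subr0 1).
  suff E : \sum_(1 <= m < M) expR (- (m%:R / (2 * Y))) * (expR x - 1) <=
      1 - expR (- ((M.-1)%:R * x)).
    by apply: le_trans E _; rewrite lerD2l lerN2 expR_ge0.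
  elim: M => [|[|M] IH]; first by rewrite big_geq// mul0r oppr0 expR0 subrr.
    by rewrite big_geq// mul0r oppr0 expR0 subrr.
  rewrite big_nat_recr//= -/x; apply: le_trans (lerD IH (lexx _)) _ => /=.
  have -> : expR (- (M%:R * x)) = expR (- (M.+1%:R * x)) * expR x.
    by rewrite -expRD; congr expR; rewrite -natr1; ring.
  lra.
rewrite -mulr_suml in h.
have e1 := expR_ge1Dx x.
have s0 : 0 <= \sum_(1 <= m < M) expR (- (m%:R / (2 * Y))).
  by apply: sumr_ge0 => m _; exact: expR_ge0.
have : (\sum_(1 <= m < M) expR (- (m%:R / (2 * Y)))) * x <= 1.
  by apply: le_trans h; rewrite ler_wpM2l//; lra.
by rewrite ler_pdivrMr ?mulr_gt0// mul1r.
Qed.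

Lemma pow_ge_linear x (k : nat) : (0 < k)%N -> 0 <= x -> x - 1 <= x ^+ k.
Proof.
move=> k0 x0; case: (leP 1 x) => x1.
  have : x <= x ^+ k by rewrite -{1}(expr1 x) ler_weXn2l.
  lra.
by have := exprn_ge0 k x0; lra.
Qed.

(** Since [a = Y^(-k)], the exponent is [(p / Y)^k / 2 >= (p / Y - 1) / 2]. Summing over all
    integers instead of primes leaves a geometric series of effective length [Y]. *)
Lemma sum_exp_prime_powers_le a Y (k M : nat) : (0 < k)%N -> 0 < Y -> a * Y ^+ k = 1 ->
  \sum_(s <- prime_powers k M) expR (- (a * s%:R / 2)) <= 4 * Y.
Proof.
move=> k0 Y0 aY; rewrite big_prime_powers.
have E (m : nat) : expR (- (a * (m ^ k)%N%:R / 2)) <= 2 * expR (- (m%:R / (2 * Y))).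
  have -> : a * (m ^ k)%N%:R / 2 = (m%:R / Y) ^+ k / 2.
    rewrite natrX expr_div_n; congr (_ / 2).
    have Yk : Y ^+ k != 0 by rewrite expf_neq0// gt_eqF.
    by rewrite [RHS]mulrC -[a]mulr1 -(divff Yk) mulrA aY mul1r.
  apply: le_trans (ler_wpM2r (expR_ge0 _) expR_half_le2).
  rewrite -expRD ler_expR.
  have -> : m%:R / (2 * Y) = m%:R / Y / 2 by field; rewrite gt_eqF.
  have := @pow_ge_linear (m%:R / Y) k k0 (divr_ge0 (ler0n _ _) (ltW Y0)); lra.
apply: (@le_trans _ _ (\sum_(1 <= m < M) 2 * expR (- (m%:R / (2 * Y))))); last first.
  by rewrite -mulr_sumr; have := sum_exp_linear_le M Y0; lra.
rewrite -(big_mkord prime (fun p => expR (- (a * (p ^ k)%N%:R / 2)))).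
case: M => [|M]; first by rewrite !big_geq.
rewrite big_ltn_cond//= [leRHS]big_mkcond /= big_mkcond /=.
by apply: ler_sum => m _; case: ifP => _; [exact: E|rewrite mulr_ge0 ?expR_ge0].
Qed.

(** With [x = a s], each term is [a^(-j) e^{-x} (x / (1 - e^{-x}))^j], at most [(8 / a)^j e^{-x/2}]
    when [j <= 4]. *)
Lemma saddle_moment_le a Y (k M j : nat) : (0 < k)%N -> 0 < Y -> 0 < a -> a * Y ^+ k = 1 ->
  (j <= 4)%N ->
  saddle_moment (prime_powers k M) (expR (- a)) j <= 4 * 8 ^+ j * Y / a ^+ j.
Proof.
move=> k0 Y0 a0 aY j4.
have E s : (0 < s)%N -> expR (- a) ^+ s / (1 - expR (- a) ^+ s) ^+ j * s%:R ^+ j <=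
    8 ^+ j / a ^+ j * expR (- (a * s%:R / 2)).
  move=> s0; rewrite -expRM_natr mulNr.
  set x := a * s%:R; have x0 : 0 < x by rewrite mulr_gt0// ltr0n.
  have -> : s%:R = x / a by rewrite /x mulrC mulKf// gt_eqF.
  have h := div_one_sub_exp_le x0.
  have e1 : expR (- x) < 1 by rewrite expR_lt1 oppr_lt0.
  have -> : expR (- x) / (1 - expR (- x)) ^+ j * (x / a) ^+ j =
     (a ^+ j)^-1 * (expR (- x) * (x / (1 - expR (- x))) ^+ j).
    by rewrite !expr_div_n; ring.
  have -> : 8 ^+ j / a ^+ j * expR (- (x / 2)) = (a ^+ j)^-1 * (8 ^+ j * expR (- (x / 2))) by ring.
  rewrite ler_pM2l ?invr_gt0 ?exprn_gt0//.
  have h2 : (x / (1 - expR (- x))) ^+ j <= 8 ^+ j * expR (x / 8) ^+ j.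
    have q0 : 0 <= x / (1 - expR (- x)) by apply: divr_ge0; lra.
    by rewrite -exprMn lerXn2r// nnegrE (le_trans q0).
  apply: le_trans (ler_wpM2l (expR_ge0 _) h2) _.
  rewrite mulrCA ler_pM2l ?exprn_gt0// -expRM_natr -expRD ler_expR.
  have : j%:R <= 4 :> R by rewrite (ler_nat R j 4).
  nra.
rewrite /saddle_moment big_seq.
apply: le_trans.
  apply: ler_sum => s sS; apply: E; exact: (allP (prime_powers_gt0 k M)).
rewrite -big_seq -mulr_sumr.
have c0 : 0 <= 8 ^+ j / a ^+ j :> R by rewrite divr_ge0 ?exprn_ge0// ltW.
apply: le_trans (ler_wpM2l c0 (sum_exp_prime_powers_le M k0 Y0 aY)) _.
by rewrite le_eqVlt; apply/orP; left; apply/eqP; ring.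
Qed.

Lemma geo_weight_ge a (s : nat) : 0 < a -> (0 < s)%N -> a * s%:R <= 1 ->
  1 / (4 * a ^+ 2) <= expR (- a) ^+ s / (1 - expR (- a) ^+ s) ^+ 2 * s%:R ^+ 2.
Proof.
move=> a0 s0 as1; rewrite -expRM_natr mulNr.
set x := a * s%:R in as1 *; have x0 : 0 < x by rewrite mulr_gt0// ltr0n.
have e1 : expR (- x) < 1 by rewrite expR_lt1 oppr_lt0.
have e2 := expR_ge1Dx (- x).
have -> : s%:R = x / a by rewrite /x mulrC mulKf// gt_eqF.
have h : (1 - expR (- x)) ^+ 2 <= x ^+ 2.
  by apply: lerXn2r; rewrite ?nnegrE; lra.
have h3 : 1 / 4 <= expR (- x).
  by apply: le_trans expR_opp1_ge _; rewrite ler_expR lerN2.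
have D0 : 0 < (1 - expR (- x)) ^+ 2 by rewrite exprn_gt0// subr_gt0.
rewrite expr_div_n.
have -> : expR (- x) / (1 - expR (- x)) ^+ 2 * (x ^+ 2 / a ^+ 2) =
   (a ^+ 2)^-1 * (expR (- x) * x ^+ 2 / (1 - expR (- x)) ^+ 2) by ring.
have -> : 1 / (4 * a ^+ 2) = (a ^+ 2)^-1 * (1 / 4) by field; rewrite gt_eqF.
rewrite ler_pM2l ?invr_gt0 ?exprn_gt0// ler_pdivlMr//.
by apply: ler_pM => //; exact: ltW.
Qed.

Definition prime_count (Z : nat) : nat := \sum_(p < Z | prime p) 1.

(** Each prime [p < Z] satisfies [a p^k <= 1] and alone contributes at least [1 / (4 a^2)]; the
    other terms are nonnegative. *)
Lemma saddle_moment2_ge a (k M Z : nat) : (0 < k)%N -> 0 < a -> a * (Z ^ k)%N%:R <= 1 -> (Z <= M)%N ->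
  (prime_count Z)%:R / (4 * a ^+ 2) <= saddle_moment (prime_powers k M) (expR (- a)) 2.
Proof.
move=> k0 a0 aZ ZM; rewrite /saddle_moment big_prime_powers.
rewrite /prime_count natr_sum mulr_suml.
rewrite (big_ord_widen_cond M (fun p => prime p) (fun p => 1%N%:R / (4 * a ^+ 2) : R))//.
rewrite big_mkcond [leRHS]big_mkcond /=; apply: ler_sum => p _.
have a1 : expR (- a) <= 1 by rewrite expR_le1 oppr_le0 ltW.
case: ifP => [/andP[pp pZ]|_].
  rewrite pp; apply: geo_weight_ge => //; first by rewrite expn_gt0 prime_gt0.
  by apply: le_trans aZ; rewrite ler_pM2l// ler_nat leq_exp2r// ltnW.
case: ifP => // _; apply: mulr_ge0; last by rewrite exprn_ge0.
apply: divr_ge0; first by rewrite exprn_ge0 ?expR_ge0.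
by rewrite exprn_ge0// subr_ge0 exprn_ile1// expR_ge0.
Qed.

Lemma geo_var_ge a (s : nat) t x : 0 < a -> (0 < s)%N -> a * s%:R <= 1 -> 0 <= x ->
  x <= `|sin (s%:R * t / 2)| ->
  1 + (x / (a * s%:R)) ^+ 2 <= geo_var (expR (- a) ^+ s) (s%:R * t).
Proof.
move=> a0 s0 as1 x0 x_le; rewrite /geo_var lerD2l.
have sn0 : 0 < s%:R :> R by rewrite ltr0n.
have h := geo_weight_ge a0 s0 as1.
set b := expR (- a) ^+ s / _ in h *.
have b1 : 1 / (4 * (a * s%:R) ^+ 2) <= b.
  have -> : 1 / (4 * (a * s%:R) ^+ 2) = 1 / (4 * a ^+ 2) / s%:R ^+ 2.
    by field; rewrite !gt_eqF.
  by rewrite ler_pdivrMr ?exprn_gt0.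
have x2 : x ^+ 2 <= sin (s%:R * t / 2) ^+ 2.
  by rewrite -[leRHS]real_normK ?num_real// lerXn2r ?nnegrE.
have -> : (x / (a * s%:R)) ^+ 2 = 4 * (1 / (4 * (a * s%:R) ^+ 2)) * x ^+ 2.
  by field; rewrite !gt_eqF.
apply: ler_pM => //; rewrite ?sqr_ge0// ?ler_pM2l//.
by rewrite mulr_ge0// divr_ge0// mulr_ge0// sqr_ge0.
Qed.

End moment_bounds.

(** Legendre's formula: the difference of [2n %/ p^k] and twice [n %/ p^k] is at most 1, and it is 0
    once [p^k > 2n]. *)
Lemma logn_central_bin (p n : nat) : prime p -> (0 < n)%N ->
  (p ^ logn p 'C(n + n, n) <= n + n)%N.
Proof.
move=> p_pr n0.
have p1 := prime_gt1 p_pr.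
have n2 : (0 < n + n)%N by rewrite addn_gt0 n0.
have binE := bin_fact (leq_addr n n); rewrite addnK in binE.
have Cgt0 : (0 < 'C(n + n, n))%N by rewrite bin_gt0 leq_addr.
have := congr1 (logn p) binE.
rewrite !lognM ?fact_gt0// ?muln_gt0 ?fact_gt0// !logn_fact//.
set L := trunc_log p (n + n).
have sumE m : (m <= n + n)%N ->
    (\sum_(1 <= k < m.+1) m %/ p ^ k = \sum_(1 <= k < (n + n).+1) m %/ p ^ k)%N.
  move=> mn; rewrite [RHS](@big_cat_nat _ _ _ m.+1)//= [X in (_ + X)%N]big_nat_cond.
  rewrite [X in (_ + X)%N]big1 ?addn0// => i /andP[/andP[mi _] _].
  by rewrite divn_small// (leq_trans mi)// ltnW// ltn_expl.
rewrite (sumE n) ?leq_addr// => logE.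
have Lle : (L <= n + n)%N.
  have := trunc_logP p1 n2; rewrite -/L => h; apply: leq_trans h.
  exact/ltnW/ltn_expl.
have : (logn p 'C(n + n, n) <= L)%N.
  have : (\sum_(1 <= k < (n + n).+1) (n + n) %/ p ^ k <=
     \sum_(1 <= k < (n + n).+1) (n %/ p ^ k + n %/ p ^ k + (k <= L)))%N.
    apply: leq_sum => k _; case: (leqP k L) => kL /=.
      have pk0 : (0 < p ^ k)%N by rewrite expn_gt0 (ltnW p1).
      have h1 := divn_eq n (p ^ k); have h2 := ltn_pmod n pk0.
      rewrite -ltnS ltn_divLR//; move: (n %/ p ^ k)%N (n %% p ^ k)%N h1 h2 => x y -> *; nia.
    rewrite divn_small// (leq_trans (trunc_log_ltn _ p1))//.
    by rewrite leq_exp2l.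
  rewrite !big_split /=.
  have : (\sum_(1 <= k < (n + n).+1) (k <= L) <= L)%N.
    rewrite (@big_cat_nat _ _ _ L.+1)//= [X in (_ + X)%N]big_nat_cond.
    rewrite [X in (_ + X)%N]big1 ?addn0; last first.
      by move=> i /andP[/andP[iL _] _]; rewrite leqNgt iL.
    have {3}-> : L = (\sum_(1 <= i < L.+1) 1)%N by rewrite sum_nat_const_nat muln1 subn1.
    by apply: leq_sum => i _; case: (i <= _)%N.
  lia.
move=> h; apply: leq_trans (trunc_logP p1 n2).
by rewrite leq_exp2l.
Qed.

Lemma prime_dvd_fact (p n : nat) : prime p -> (p %| n`!)%N -> (p <= n)%N.
Proof.
move=> p_pr; elim: n => [|n IH]; first by rewrite fact0 dvdn1 => /eqP p1; rewrite p1 in p_pr.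
by rewrite factS Euclid_dvdM// => /orP[/dvdn_leq->//|/IH/leqW].
Qed.

(** The central binomial coefficient is at least [2^n] by Vandermonde's identity, and it is a
    product of prime powers, each at most [2n], over distinct primes up to [2n]. *)
Lemma prime_count_ge (n : nat) : (0 < n)%N ->
  (2 ^ n <= (n + n) ^ prime_count (n + n).+1)%N.
Proof.
move=> n0.
have Cgt0 : (0 < 'C(n + n, n))%N by rewrite bin_gt0 leq_addr.
apply: (@leq_trans 'C(n + n, n)).
  rewrite -binomial.Vandermonde -[X in (X ^ _ <= _)%N]/(1 + 1)%N expnDn.
  apply: leq_sum => j _; rewrite !exp1n !muln1 leq_pmulr// bin_gt0; lia.
rewrite [X in (X <= _)%N]prod_prime_decomp// prime_decompE big_map /=.
apply: (@leq_trans (\prod_(p <- primes 'C(n + n, n)) (n + n))%N).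
  rewrite big_seq [X in (_ <= X)%N]big_seq; apply: leq_prod => p.
  by rewrite mem_primes => /and3P[p_pr _ _]; exact: logn_central_bin.
rewrite big_const_seq count_predT iter_muln_1 leq_pexp2l ?addn_gt0 ?n0//.
rewrite /prime_count -(big_mkord prime (fun=> 1%N)) -big_filter sum1_size.
apply: uniq_leq_size; first exact: primes_uniq.
move=> p; rewrite mem_primes mem_filter mem_index_iota /= => /and3P[p_pr _ p_dvd].
rewrite p_pr /= ltnS leqNgt; apply/negP => np.
have : (p %| (n + n)`!)%N by rewrite -(bin_fact (leq_addr n n)) dvdn_mulr.
by move/(prime_dvd_fact p_pr); rewrite leqNgt np.
Qed.

Section chebyshev.
Variable R : realType.

(* Chebyshev's [pi(x) >> x / log x] for [x = W^d], giving away one factor [W] to absorb the logarithm. *)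
Lemma prime_count_power (d : nat) : (0 < d)%N ->
  exists W0 : R, forall W : R, W0 <= W ->
    exists Z : nat, Z%:R <= W ^+ d /\ W ^+ d.-1 <= (prime_count Z)%:R.
Proof.
move=> d0; have l2 : 0 < ln 2 :> R by rewrite ln_gt0// ltr1n.
pose c : R := ln 2 / (8 * d%:R).
have c0 : 0 < c by rewrite divr_gt0// mulr_gt0// ltr0n.
exists (Num.max 8 ((2 / c) ^+ 2)) => W; rewrite ge_max => /andP[W8 Wc].
have W0 : 0 < W by lra.
(* As [W^d >= 8], this gives both [2n + 1 <= W^d] and [n >= W^d / 8]. *)
pose n := Num.truncn (W ^+ d / 4).
have W1 : 1 <= W by lra.
have Wd8 : 8 <= W ^+ d by apply: le_trans W8 _; rewrite -[leLHS]expr1 ler_weXn2l.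
have /andP[n1 n2] : n%:R <= W ^+ d / 4 < n.+1%:R.
  by apply: truncn_itv; rewrite divr_ge0// exprn_ge0// ltW.
have n_gt0 : (0 < n)%N by rewrite lt0n; apply/eqP => n0; rewrite n0 in n2; lra.
exists (n + n).+1; split; first by rewrite -[(n + n).+1%:R]natr1 natrD; lra.
have h := prime_count_ge n_gt0.
have {h}h : (2 ^ n)%N%:R <= ((n + n) ^ prime_count (n + n).+1)%N%:R :> R by rewrite ler_nat.
rewrite !natrX -ler_ln ?posrE ?exprn_gt0 ?ltr0n ?addn_gt0 ?n_gt0// !lnXn// ?ltr0n ?addn_gt0 ?n_gt0// in h.
set q := prime_count _ in h *.
have lW : ln ((n + n)%N%:R : R) <= d%:R * ln W.
  rewrite mulr_natl -lnXn// ler_ln ?posrE ?exprn_gt0 ?ltr0n ?addn_gt0 ?n_gt0// natrD; lra.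
have sW : ln W <= 2 * Num.sqrt W.
  have s0 : 0 < Num.sqrt W by rewrite sqrtr_gt0.
  rewrite -{1}(sqr_sqrtr (ltW W0)) lnXn// mulr2n.
  have := ln_sublinear s0; lra.
have sW2 : 2 / c <= Num.sqrt W.
  have c2 : 0 <= 2 / c by rewrite divr_ge0// ltW.
  by rewrite -(ger0_norm c2) -sqrtr_sqr ler_wsqrtr.
have lnW : ln W <= c * W.
  apply: le_trans sW _; rewrite -{2}(sqr_sqrtr (ltW W0)) expr2.
  rewrite ler_pdivrMr// in sW2; have := sqrtr_ge0 W; nra.
have lW0 : 0 < ln W by rewrite ln_gt0//; lra.
have h2 : W ^+ d / 8 * ln 2 <= q%:R * (d%:R * ln W).
  apply: (@le_trans _ _ (n%:R * ln 2)).
    by rewrite (ler_wpM2r (ltW l2))//; rewrite -[n.+1%:R]natr1 in n2; lra.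
  rewrite -[leLHS]mulr_natl -[leRHS]mulr_natl in h.
  by apply: le_trans h _; rewrite ler_wpM2l.
have Wd : W ^+ d = W ^+ d.-1 * W by rewrite -exprSr prednK.
have d0' : 0 < d%:R :> R by rewrite ltr0n.
have h3 : W ^+ d.-1 * W * c <= q%:R * (c * W).
  rewrite -Wd /c; apply: le_trans (_ : q%:R * ln W <= _); last by rewrite ler_wpM2l.
  have -> : W ^+ d * (ln 2 / (8 * d%:R)) = W ^+ d / 8 * ln 2 / d%:R by field; rewrite gt_eqF.
  rewrite ler_pdivrMr//; apply: le_trans h2 _; lra.
by rewrite -mulrA [W * c]mulrC ler_pM2r// mulr_gt0 in h3.
Qed.

End chebyshev.

(** * Minor arcs *)

Section minor_arcs.
Variable R : realType.
Implicit Types (a t x y W : R).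

Lemma ler_exp x y (n : nat) : 0 <= x -> x <= y -> x ^+ n <= y ^+ n.
Proof. by move=> x0 xy; rewrite lerXn2r ?nnegrE// (le_trans x0). Qed.

Lemma prod_ge1_sub (I : eqType) (s : seq I) (g : I -> R) :
  {in s, forall i, 1 <= g i} -> 1 <= \prod_(i <- s) g i.
Proof.
elim: s => [|i s IH] h; first by rewrite big_nil.
rewrite big_cons mulr_ege1 ?h ?mem_head// IH// => j js.
by rewrite h// inE js orbT.
Qed.

Lemma prod_ge_all (I : eqType) (s : seq I) (g : I -> R) (c : R) : 0 <= c ->
  {in s, forall i, c <= g i} -> c ^+ size s <= \prod_(i <- s) g i.
Proof.
move=> c0; elim: s => [|i s IH] h; first by rewrite big_nil.
rewrite big_cons exprS ler_pM ?exprn_ge0 ?h ?mem_head// IH// => j js.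
by rewrite h// inE js orbT.
Qed.

(** Two factors below [c] would contradict the pairwise hypothesis, so at most one is lost, and it
    is still at least 1. *)
Lemma prod_ge_all_but_one (I : eqType) (s : seq I) (g : I -> R) (c : R) : 0 <= c -> uniq s ->
  {in s, forall i, 1 <= g i} ->
  {in s &, forall i j, i != j -> (c <= g i) || (c <= g j)} ->
  c ^+ (size s).-1 <= \prod_(i <- s) g i.
Proof.
move=> c0; elim: s => [|i s IH]; first by rewrite big_nil.
move=> /= /andP[i_s us] g1 gc; rewrite big_cons.
have g1s : {in s, forall j, 1 <= g j} by move=> j js; rewrite g1// inE js orbT.
have [c_i|i_c] := leP c (g i).
  case: s => [|j s] in IH i_s us g1 gc g1s *; first by rewrite big_nil mulr1 g1 ?mem_head.
  rewrite [size _]/= exprS ler_pM ?exprn_ge0// IH// => x y xs ys.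
  by apply: gc; rewrite inE ?xs ?ys orbT.
rewrite -[leLHS]mul1r ler_pM ?exprn_ge0 ?g1 ?mem_head//.
apply: prod_ge_all => // j js.
have := gc i j (mem_head _ _); rewrite inE js orbT => /(_ isT).
rewrite leNgt i_c /=; apply; apply: contraNneq i_s => -> //.
Qed.

Lemma prime_countE (Z : nat) : prime_count Z = size [seq p <- iota 0 Z | prime p].
Proof.
by rewrite /prime_count -(big_mkord prime (fun=> 1%N)) -big_filter sum1_size /index_iota subn0.
Qed.

Lemma saddle_amp_sqrt (S : seq nat) rho t : 0 < rho < 1 -> all (fun s => 0 < s)%N S ->
  saddle_amp S rho t = (Num.sqrt (\prod_(s <- S) geo_var (rho ^+ s) (s%:R * t)))^-1.
Proof.
move=> rho01; elim: S => [_|s S IH /= /andP[s0 S0]].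
  by rewrite /saddle_amp !big_nil sqrtr1 invr1.
have g1 := geo_var_ge1 (s%:R * t) (expr_pow_itv rho01 s0).
rewrite /saddle_amp !big_cons -/(saddle_amp S rho t) IH// -invfM -sqrtrM//.
exact: le_trans g1.
Qed.

(** All factors [geo_var] are at least 1, so the primes below [Z] may be used alone. The exponent
    doubles because the amplitude is an inverse square root. *)
Lemma saddle_amp_minor (k Z M K : nat) a t W : 0 < a -> 0 < W -> (Z <= M)%N ->
  W ^+ (2 * K) <= \prod_(s <- prime_powers k Z) geo_var (expR (- a) ^+ s) (s%:R * t) ->
  saddle_amp (prime_powers k M) (expR (- a)) t <= W ^- K.
Proof.
move=> a0 W0 ZM hZ.
have rho01 : 0 < expR (- a) < 1 by rewrite expR_gt0 expR_lt1 oppr_lt0.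
rewrite saddle_amp_sqrt ?prime_powers_gt0//.
rewrite lef_pV2 ?posrE ?exprn_gt0//; last first.
  rewrite sqrtr_gt0 (lt_le_trans ltr01)// prod_ge1_sub// => s sS.
  by rewrite geo_var_ge1// expr_pow_itv// (allP (prime_powers_gt0 k M)).
rewrite -(ger0_norm (exprn_ge0 K (ltW W0))) -sqrtr_sqr ler_wsqrtr// -exprM mulnC.
apply: le_trans hZ _.
have -> : prime_powers k M = prime_powers k Z ++
    [seq (p ^ k)%N | p <- iota Z (M - Z) & prime p].
  by rewrite /prime_powers -{1}(subnKC ZM) iotaD filter_cat map_cat.
rewrite big_cat /= ler_peMr//.
  rewrite (le_trans ler01)// prod_ge1_sub// => s sS.
  by rewrite geo_var_ge1// expr_pow_itv// (allP (prime_powers_gt0 k Z)).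
rewrite prod_ge1_sub// => s /mapP[p]; rewrite mem_filter => /andP[p_pr _] ->.
by rewrite geo_var_ge1// expr_pow_itv// expn_gt0 prime_gt0.
Qed.

Lemma expR_le_oneD y : 0 <= y <= 1 -> expR (y / 2) <= 1 + y.
Proof.
move=> /andP[y0 y1]; have h := @expR_quadratic_le R (y / 2).
have /h/andP[_] : 0 <= y / 2 <= 1 / 2 by apply/andP; split; lra.
by rewrite expr_div_n; nra.
Qed.

(** The angles [s t / 2] are at most [1 / 2], so each sine is at least half its angle. In the ratio
    of this bound to [a s] the factor [s] cancels, and every prime gains the same amount. *)
Lemma prod_geo_var_small_angle (k Z : nat) a t : (0 < k)%N -> 0 < a -> 0 <= t ->
  a * Z%:R ^+ k <= 1 -> Z%:R ^+ k * t <= 1 ->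
  (1 + (t / (4 * a)) ^+ 2) ^+ prime_count Z <=
  \prod_(s <- prime_powers k Z) geo_var (expR (- a) ^+ s) (s%:R * t).
Proof.
move=> k0 a0 t0 aZ Zt.
have -> : prime_count Z = size (prime_powers k Z) by rewrite prime_countE size_map.
apply: prod_ge_all; first by rewrite addr_ge0// sqr_ge0.
move=> s /mapP[p]; rewrite mem_filter mem_iota /= add0n => /andP[p_pr pZ] sE.
have s0 : (0 < s)%N by rewrite sE expn_gt0 prime_gt0.
have sn0 : 0 < s%:R :> R by rewrite ltr0n.
have sZ : s%:R <= Z%:R ^+ k :> R by rewrite sE -natrX ler_nat leq_exp2r// ltnW.
have as1 : a * s%:R <= 1 by apply: le_trans aZ; rewrite ler_pM2l.
have st1 : s%:R * t <= 1 by apply: le_trans Zt; rewrite ler_wpM2r.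
have st0 : 0 <= s%:R * t by rewrite mulr_ge0.
have v0 : 0 <= s%:R * t / 2 by lra.
have hs : s%:R * t / 4 <= `|sin (s%:R * t / 2)|.
  apply: le_trans (ler_norm _); apply: le_trans (sin_ge_cubic v0).
  set v := s%:R * t / 2 in v0 *; have v1 : v <= 1 / 2 by rewrite /v; lra.
  have -> : s%:R * t / 4 = v / 2 by rewrite /v; lra.
  have : v ^+ 2 <= 1 by nra.
  by rewrite exprS; nra.
have x0 : 0 <= s%:R * t / 4 by lra.
have := geo_var_ge a0 s0 as1 x0 hs.
by have -> : s%:R * t / 4 / (a * s%:R) = t / (4 * a) by field; rewrite !gt_eqF.
Qed.

Lemma norm_sin_natM (n : nat) x : `|sin (n%:R * x)| <= n%:R * `|sin x|.
Proof.
elim: n => [|n IH]; first by rewrite !mul0r sin0 normr0.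
rewrite -natr1 !mulrDl !mul1r sinD; apply: le_trans (ler_normD _ _) _.
rewrite !normrM; apply: lerD.
  by apply: le_trans IH; rewrite ler_piMr// cos_max.
by rewrite ler_piMl// cos_max.
Qed.

Lemma sin_ge_quarter x : 0 <= x <= pi / 2 -> x / 4 <= sin x.
Proof.
move=> /andP[x0 x1]; have p2 := @pihalf_lt2 R; have p1 := @pihalf_ge1 R.
case: (leP x 1) => x_1.
  by apply: le_trans (sin_ge_cubic x0); nra.
have : sin 1 <= sin x.
  have [->//|h] := eqVneq x 1; apply: ltW.
  rewrite (@ltr_sin R)// ?in_itv/= ?x1 ?andbT; lra.
by have := @sin_ge_cubic R 1 ler01; rewrite !expr1n; lra.
Qed.

(* If [u m = 1 + v n], then [sin x] is controlled by [sin (m x)] and [sin (n x)]: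
   two coprime multiples of an angle cannot both be nearly multiples of [pi]. *)
Lemma sin_coprime (m n : nat) x : (0 < m)%N -> (0 < n)%N -> coprime m n ->
  `|sin x| <= n%:R * `|sin (m%:R * x)| + m%:R * `|sin (n%:R * x)|.
Proof.
move=> m0 n0 cop.
have [v vm] := Bezoutl n m0; rewrite (eqP cop) => /dvdnP[u uE].
have un : (u <= n)%N.
  rewrite -(leq_pmul2r m0) -uE; move: vm n0 m0; nia.
have xE : x = u%:R * (m%:R * x) - v%:R * (n%:R * x).
  by rewrite !mulrA -!natrM -uE natrD natrM; ring.
rewrite {1}xE sinB; apply: le_trans (ler_normB _ _) _; rewrite !normrM.
apply: lerD.
  apply: (@le_trans _ _ `|sin (u%:R * (m%:R * x))|); first by rewrite ler_piMr// cos_max.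
  by apply: le_trans (norm_sin_natM _ _) _; rewrite ler_wpM2r// ler_nat.
apply: (@le_trans _ _ `|sin (v%:R * (n%:R * x))|); first by rewrite ler_piMl// cos_max.
by apply: le_trans (norm_sin_natM _ _) _; rewrite ler_wpM2r// ler_nat ltnW.
Qed.

(** Here [sin (t / 2) >= t / 8]. If two prime powers [m, n <= Z^k] both had sines below
    [t / (16 Z^k)], then [sin_coprime] would force [sin (t / 2) < t / 8]. Dividing by [a s <= a Z^k]
    produces the second factor [Z^k]. *)
Lemma prod_geo_var_large_angle (k Z : nat) a t : (0 < k)%N -> (0 < Z)%N -> 0 < a -> 0 <= t <= pi ->
  a * Z%:R ^+ k <= 1 ->
  (1 + (t / (16 * Z%:R ^+ (2 * k) * a)) ^+ 2) ^+ (prime_count Z).-1 <=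
  \prod_(s <- prime_powers k Z) geo_var (expR (- a) ^+ s) (s%:R * t).
Proof.
move=> k0 Z0 a0 /andP[t0 t1] aZ.
have rho01 : 0 < expR (- a) < 1 by rewrite expR_gt0 expR_lt1 oppr_lt0.
have -> : prime_count Z = size (prime_powers k Z) by rewrite prime_countE size_map.
have Zk0 : 0 < Z%:R ^+ k :> R by rewrite exprn_gt0// ltr0n.
apply: prod_ge_all_but_one; first by rewrite addr_ge0// sqr_ge0.
- exact: prime_powers_uniq.
- by move=> s sS; rewrite geo_var_ge1// expr_pow_itv// (allP (prime_powers_gt0 k Z)).
move=> m n mS nS mn.
have sS s : s \in prime_powers k Z -> (0 < s)%N /\ s%:R <= Z%:R ^+ k :> R.
  move=> /mapP[p]; rewrite mem_filter mem_iota /= add0n => /andP[p_pr pZ] ->.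
  by rewrite expn_gt0 prime_gt0// -natrX ler_nat leq_exp2r// ltnW.
have cop : coprime m n.
  move: mS nS mn => /mapP[p]; rewrite mem_filter => /andP[p_pr _] -> /mapP[q].
  rewrite mem_filter => /andP[q_pr _] -> pq; rewrite coprimeXl// coprimeXr//.
  rewrite prime_coprime// dvdn_prime2//; apply: contraNneq pq => -> //.
have [m0 mZ] := sS _ mS; have [n0 nZ] := sS _ nS.
have h := sin_coprime (t / 2) m0 n0 cop.
have h1 : t / 8 <= `|sin (t / 2)|.
  apply: le_trans (ler_norm _).
  have -> : t / 8 = t / 2 / 4 by lra.
  by apply: sin_ge_quarter; apply/andP; split; lra.
have D0 : 0 < 16 * Z%:R ^+ k :> R by rewrite mulr_gt0.
have x0 : 0 <= t / (16 * Z%:R ^+ k) by rewrite divr_ge0// ltW.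
have key s : s \in prime_powers k Z -> t / (16 * Z%:R ^+ k) <= `|sin (s%:R * (t / 2))| ->
    1 + (t / (16 * Z%:R ^+ (2 * k) * a)) ^+ 2 <= geo_var (expR (- a) ^+ s) (s%:R * t).
  move=> /sS[s0 sZ] hs; rewrite mulrA in hs.
  have as1 : a * s%:R <= 1 by apply: le_trans aZ; rewrite ler_pM2l.
  apply: le_trans (geo_var_ge a0 s0 as1 x0 hs); rewrite lerD2l.
  have sn0 : 0 < s%:R :> R by rewrite ltr0n.
  rewrite lerXn2r ?nnegrE//; first by rewrite divr_ge0// !mulr_ge0// ltW// exprn_gt0// ltr0n.
    by rewrite divr_ge0// mulr_ge0// ltW.
  have -> : Z%:R ^+ (2 * k) = Z%:R ^+ k * Z%:R ^+ k :> R by rewrite -expr2 -exprM mulnC.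
  have D1 : 0 < 16 * Z%:R ^+ k * a by rewrite mulr_gt0.
  rewrite -[leRHS]mulrA -invfM ler_wpM2l// lef_pV2 ?posrE ?mulr_gt0//.
  have -> : 16 * Z%:R ^+ k * (a * s%:R) = 16 * Z%:R ^+ k * a * s%:R by ring.
  have -> : 16 * (Z%:R ^+ k * Z%:R ^+ k) * a = 16 * Z%:R ^+ k * a * Z%:R ^+ k by ring.
  by rewrite ler_pM2l.
case: (leP (t / (16 * Z%:R ^+ k)) `|sin (m%:R * (t / 2))|) => hm; first by rewrite key.
case: (leP (t / (16 * Z%:R ^+ k)) `|sin (n%:R * (t / 2))|) => hn; first by rewrite [X in _ || X]key// orbT.
exfalso; move: hm hn; rewrite !ltr_pdivlMr//.
have am := normr_ge0 (sin (m%:R * (t / 2))); have an := normr_ge0 (sin (n%:R * (t / 2))).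
move: (`|sin (m%:R * _)|) (`|sin (n%:R * _)|) am an h => p q p0 q0 h hm hn.
have := ler_pM (ler0n _ n) p0 nZ (lexx p); have := ler_pM (ler0n _ m) q0 mZ (lexx q).
lra.
Qed.

Lemma expR_eventually_ge (c : R) (n : nat) : 0 < c ->
  exists W0, forall W, W0 <= W -> W ^+ n <= expR (c * W).
Proof.
move=> c0; exists (Num.max 1 (n.+1`!%:R / c ^+ n.+1)) => W; rewrite ge_max => /andP[W1 hW].
have W0 : 0 < W by lra.
have cW : 0 <= c * W by rewrite mulr_ge0// ltW.
have := expR_ge1Dxn n cW; apply: le_trans.
have f0 : 0 < n.+1`!%:R :> R by rewrite ltr0n fact_gt0.
have : W ^+ n <= (c * W) ^+ n.+1 / n.+1`!%:R; last by lra.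
rewrite ler_pdivlMr// exprMn [W ^+ n.+1]exprSr.
rewrite ler_pdivrMr ?exprn_gt0// in hW.
by rewrite mulrCA ler_pM2l ?exprn_gt0// mulrC.
Qed.

(* The scale [W] is chosen so that [X = 1/a = W^(8ek)] and [X^(1/k) = W^(8e)] with [e = 2k + 3] have
   integral exponents. For [t <= X^(-1/2)] all primes [p] with [p^k <= min(X, 1/t)] contribute;
   for larger [t] a fixed finite set of primes suffices. *)
Lemma minor_arc_bound (k K : nat) : (0 < k)%N ->
  exists W0, forall W, W0 <= W -> forall (M : nat) t, W ^+ (8 * (2 * k + 3)) <= M%:R ->
    W * W ^- (4 * (2 * k + 3)) * W ^- (8 * (2 * k + 3) * k) <= t <= pi ->
    saddle_amp (prime_powers k M) (expR (- W ^- (8 * (2 * k + 3) * k))) t <= W ^- K.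
Proof.
move=> k0; have : (2 < 2 * k + 3)%N by lia.
move: (2 * k + 3)%N => e e3.
have e8 : (0 < 8 * e)%N by lia.
have e84 : (8 * e = 4 * e * 2)%N by lia.
have le48 : (4 * e <= 8 * e)%N by lia.
have le48k : (4 * e * k <= 8 * e * k)%N by nia.
have le1 : (1 <= (4 * e).-1)%N by lia.
have lek : (k <= 8 * e * k)%N by nia.
have le2 : (2 + 4 * e * k <= 8 * e * k)%N by nia.
have e4 : (0 < 4 * e)%N by lia.
have [V1 hV1] := prime_count_power R e8.
have [V2 hV2] := prime_count_power R e4.
have [V3 hV3] := @prime_count_power R 2 isT.
have i32 : 0 < 1 / 32 :> R by lra.
have [V4 hV4] := expR_eventually_ge (2 * K) i32.
have hV : V3 <= Num.max V3 K.+1%:R by rewrite le_max lexx.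
(* The finite set of primes for large [t]: it has more than [K] elements and is fixed before [W]. *)
have [Z [_ ZK]] := hV3 _ hV.
have {}ZK : (K < prime_count Z)%N.
  have : K.+1%:R <= (prime_count Z)%:R :> R.
    by apply: le_trans ZK; rewrite /= expr1 le_max lexx orbT.
  by rewrite ler_nat.
exists (Num.max (Num.max V1 V2) (Num.max V4 (Num.max 1 (16 * Z%:R ^+ (2 * k) + Z%:R)))).
move=> W; rewrite !ge_max => /andP[/andP[WV1 WV2] /andP[WV4 /andP[W1 WZ]]].
have W0 : 0 < W by lra.
have Wn n : 0 < W ^+ n by rewrite exprn_gt0.
have Wn1 n : 1 <= W ^+ n by rewrite exprn_ege1.
set a := W ^- (8 * e * k); have a0 : 0 < a by rewrite invr_gt0.
move=> M t WM /andP[t1 t2].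
have t0 : 0 < t by apply: lt_le_trans t1; rewrite !mulr_gt0// invr_gt0.
(* Range [t <= a]: at least [W^(8e-1)] primes each gain a factor [1 + y] with [y >= W^(2-8e) / 16],
   so the logarithm of the product is at least [W / 32]. *)
case: (leP t a) => ta.
  have [Z1 [Z1W Z1c]] := hV1 _ WV1.
  apply: (@saddle_amp_minor k Z1) => //.
    by rewrite -(ler_nat R) (le_trans Z1W).
  have Zk : Z1%:R ^+ k <= W ^+ (8 * e * k).
    by rewrite exprM ler_exp.
  have aZ : a * Z1%:R ^+ k <= 1 by rewrite /a ler_pdivrMl// mulr1.
  have Zt : Z1%:R ^+ k * t <= 1.
    apply: (@le_trans _ _ (Z1%:R ^+ k * a)); first by rewrite ler_wpM2l// exprn_ge0.
    by rewrite mulrC.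
  apply: le_trans (prod_geo_var_small_angle k0 a0 (ltW t0) aZ Zt).
  set y := (t / (4 * a)) ^+ 2.
  have y0 : 0 <= y by rewrite sqr_ge0.
  have y1 : y <= 1.
    have h : t / (4 * a) <= 1 by rewrite ler_pdivrMr ?mulr_gt0//; lra.
    by rewrite /y exprn_ile1// divr_ge0 ?mulr_ge0 ?ltW.
  have yI : 0 <= y <= 1 by rewrite y0 y1.
  have yW : W ^+ 2 * W ^- (8 * e) / 16 <= y.
    have -> : W ^+ 2 * W ^- (8 * e) / 16 = (W * W ^- (4 * e) / 4) ^+ 2.
      have -> : W ^+ (8 * e) = W ^+ (4 * e) ^+ 2 by rewrite e84 exprM.
      by field; rewrite gt_eqF.
    apply: ler_exp.
    + by rewrite !divr_ge0 ?exprn_ge0 ?(ltW W0).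
    + rewrite ler_pdivlMr ?mulr_gt0//; lra.
  apply: le_trans (hV4 _ WV4) _.
  apply: (@le_trans _ _ (expR (y / 2) ^+ prime_count Z1)); last first.
    by rewrite ler_exp ?expR_ge0 ?expR_le_oneD.
  rewrite -expRM_natr ler_expR.
  have := ler_pM (_ : 0 <= W ^+ 2 * W ^- (8 * e) / 16) (ltW (Wn _)) yW Z1c.
  have -> : W ^+ 2 * W ^- (8 * e) / 16 * W ^+ (8 * e).-1 = W / 16.
    have -> : W ^+ (8 * e) = W ^+ (8 * e).-1 * W by rewrite -exprSr prednK.
    by field; rewrite !gt_eqF.
  have -> : 0 <= W ^+ 2 * W ^- (8 * e) / 16 by rewrite !divr_ge0 ?exprn_ge0 ?(ltW W0).
  move=> /(_ isT); lra.
(* Range [a < t <= X^(-1/2)]: the primes with [p^k <= X^(1/2)] have small angles, each gains at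
   least the fixed factor [1 + 1/16], and there are at least [W] of them. *)
case: (leP t (W ^- (4 * e * k))) => tb.
  have [Z1 [Z1W Z1c]] := hV2 _ WV2.
  apply: (@saddle_amp_minor k Z1) => //.
    by rewrite -(ler_nat R) (le_trans Z1W)// (le_trans _ WM)// ler_weXn2l.
  have Zk : Z1%:R ^+ k <= W ^+ (4 * e * k).
    by rewrite exprM ler_exp.
  have aZ : a * Z1%:R ^+ k <= 1.
    by rewrite /a ler_pdivrMl// mulr1 (le_trans Zk)// ler_weXn2l.
  have Zt : Z1%:R ^+ k * t <= 1.
    apply: le_trans (_ : W ^+ (4 * e * k) * W ^- (4 * e * k) <= 1); last by rewrite divff// gt_eqF.
    by rewrite ler_pM ?exprn_ge0 ?(ltW t0).
  apply: le_trans (prod_geo_var_small_angle k0 a0 (ltW t0) aZ Zt).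
  apply: le_trans (hV4 _ WV4) _.
  have yI : 0 <= (1 / 16 : R) <= 1 by apply/andP; split; lra.
  apply: (@le_trans _ _ (expR (1 / 16 / 2) ^+ prime_count Z1)).
    rewrite -expRM_natr ler_expR.
    have : W <= (prime_count Z1)%:R.
      by apply: le_trans Z1c; rewrite -[leLHS]expr1 ler_weXn2l.
    lra.
  apply: ler_exp; first exact: expR_ge0.
  apply: le_trans (expR_le_oneD yI) _; rewrite lerD2l.
  have h : 1 / 4 <= t / (4 * a) by rewrite ler_pdivlMr ?mulr_gt0//; lra.
  have -> : 1 / 16 = (1 / 4) ^+ 2 :> R by field.
  by rewrite ler_exp//; lra.
(* Range [t > X^(-1/2)]: now [t / a >= W^2], and the constant [16 Z^(2k)] is at most [W]. Hence each
   prime of the fixed set, with one possible exception, gains at least [W^2]. *)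
have ZW : Z%:R <= W.
  by apply: le_trans WZ; rewrite lerDr mulr_ge0// exprn_ge0.
have Z16 : 16 * Z%:R ^+ (2 * k) <= W by apply: le_trans WZ; rewrite lerDl.
have aZ : a * Z%:R ^+ k <= 1.
  rewrite /a ler_pdivrMl// mulr1 (le_trans (_ : _ <= W ^+ k))//.
    by rewrite ler_exp.
  by rewrite ler_weXn2l.
apply: (@saddle_amp_minor k Z) => //.
  by rewrite -(ler_nat R) (le_trans ZW)// (le_trans _ WM)// -[leLHS]expr1 ler_weXn2l.
have Z0 : (0 < Z)%N.
  by case: (Z) ZK => //; rewrite /prime_count big_ord0.
have tI : 0 <= t <= pi by rewrite ltW.
apply: le_trans (prod_geo_var_large_angle k0 Z0 a0 tI aZ).
set y := t / _.
have yW : W <= y.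
  rewrite /y ler_pdivlMr; last by rewrite !mulr_gt0// exprn_gt0// ltr0n.
  apply: le_trans (ltW tb).
  apply: (@le_trans _ _ (W * (W * a))).
    by rewrite ler_pM2l// ler_pM2r.
  by rewrite /a mulrA -expr2 ler_pdivrMr// mulrC ler_pdivlMr// -exprD ler_weXn2l.
have y2 : W ^+ 2 <= 1 + y ^+ 2.
  have : W ^+ 2 <= y ^+ 2 by exact: (ler_exp 2 (ltW W0) yW).
  lra.
rewrite exprM.
apply: (@le_trans _ _ ((1 + y ^+ 2) ^+ K)).
  by rewrite ler_exp// exprn_ge0// ltW.
by rewrite ler_weXn2l ?lerDl ?sqr_ge0//; case: (prime_count Z) ZK.
Qed.

End minor_arcs.

(** * The saddle point estimate *)

Section saddle_point_estimate.
Variable R : realType.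
Local Open Scope classical_set_scope.
Local Open Scope ring_scope.
Local Notation mu := (@lebesgue_measure R).
Implicit Types (a rho t W Y : R).

Definition diff_integrand (S : seq nat) rho (n : nat) t : R :=
  saddle_amp S rho t * (rho^-1 * cos (n.+1%:R * t - saddle_phase S rho t)
    - cos (n%:R * t - saddle_phase S rho t)).

Lemma continuous_diff_integrand S rho n : 0 < rho < 1 -> all (fun s => 0 < s)%N S ->
  continuous (diff_integrand S rho n).
Proof.
move=> rho01 S0.
have -> : diff_integrand S rho n = fun t =>
    rho^-1 * (saddle_amp S rho t * cos (n.+1%:R * t - saddle_phase S rho t))
    - saddle_amp S rho t * cos (n%:R * t - saddle_phase S rho t).
  by apply/funext => t; rewrite /diff_integrand; ring.
move=> t; apply: cvgB; last exact: (continuous_coef_integrand (c := n%:R) rho01 S0).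
apply: cvgM; first exact: cvg_cst.
exact: (continuous_coef_integrand (c := n.+1%:R) rho01 S0).
Qed.

Lemma pPk_diff_integral (k n M : nat) rho : (0 < k)%N -> (n.+1 < M)%N -> 0 < rho < 1 ->
  (pPk k n.+1)%:R - (pPk k n)%:R =
  rho ^- n * (\prod_(s <- prime_powers k M) (1 - rho ^+ s)^-1) / pi *
  \int[mu]_(t in `[0%R, pi]) diff_integrand (prime_powers k M) rho n t.
Proof.
move=> k0 nM rho01; set S := prime_powers k M.
have S0 : all (fun s => 0 < s)%N S := prime_powers_gt0 k M.
move: (rho01) => /andP[r0 r1].
have T1 := coef_integral_part_count n.+1 rho01 S0.
have T0 := coef_integral_part_count n rho01 S0.
rewrite -!pPk_part_count// in T0 T1; last exact: ltnW.
have -> : \int[mu]_(t in `[0%R, pi]) diff_integrand S rho n t =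
    rho^-1 * coef_integral S rho n.+1%:Z - coef_integral S rho n%:Z.
  have c2 (c : R) := continuous_coef_integrand (c := c) rho01 S0.
  rewrite /coef_integral -RintegralZl//; last exact/integrable_0pi/c2.
  rewrite -RintegralB//; last exact/integrable_0pi/c2.
    apply: eq_Rintegral => t _; rewrite /diff_integrand -!pmulrn; ring.
  by apply: integrable_0pi => t; apply: cvgM; [exact: cvg_cst|exact: c2].
rewrite T0 T1.
have -> : \prod_(s <- S) (1 - rho ^+ s)^-1 = (\prod_(s <- S) (1 - rho ^+ s))^-1.
  by rewrite prodfV.
have P0 : \prod_(s <- S) (1 - rho ^+ s) != 0.
  rewrite prodf_seq_neq0; apply/allP => s sS /=.
  have /andP[_ h] := expr_pow_itv rho01 (allP S0 s sS).
  by rewrite gt_eqF// subr_gt0.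
have pi0 : pi != 0 :> R by rewrite gt_eqF// pi_gt0.
have rn0 : rho ^+ n != 0 by rewrite expf_neq0// gt_eqF.
rewrite exprS; move: (pi : R) pi0 {T0 T1} => p p0; field.
by rewrite p0 P0 rn0 gt_eqF.
Qed.

Lemma gaussian_mass_scale (b : R) : 0 < b ->
  Num.sqrt (pi / (b / 4)) = Num.sqrt 2 * Num.sqrt (pi / (b / 2)).
Proof.
by move=> b0; rewrite -sqrtrM//; congr Num.sqrt; field; rewrite gt_eqF.
Qed.

Lemma gaussian_mass_main (b : R) : 0 < b ->
  Num.sqrt (pi / (b / 2)) / 2 / pi = (Num.sqrt (2 * pi * b))^-1.
Proof.
move=> b0; have := @pi_gt0 R; move: (pi : R) => p p0.
set q := Num.sqrt (2 * p * b).
have D0 : 0 < 2 * p * b by rewrite !mulr_gt0.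
have q0 : 0 < q by rewrite sqrtr_gt0.
have qq : q ^+ 2 = 2 * p * b by rewrite sqr_sqrtr// ltW.
have -> : p / (b / 2) = (q / b) ^+ 2.
  by rewrite expr_div_n qq; field; rewrite gt_eqF.
rewrite sqrtr_sqr ger0_norm ?divr_ge0 ?ltW//.
have -> : q / b / 2 / p = q^-1 * (q ^+ 2 / (2 * p * b)).
  by field; rewrite !gt_eqF.
by rewrite qq divff ?mulr1// gt_eqF.
Qed.

Lemma sqrt_pi_le2 : Num.sqrt pi <= 2 :> R.
Proof.
have := @pihalf_lt2 R; have := @pi_gt0 R => h1 h2.
have -> : 2 = Num.sqrt (2 ^+ 2) :> R by rewrite sqrtr_sqr ger0_norm.
rewrite ler_wsqrtr//; lra.
Qed.

Lemma saddle_integral_estimate (S : seq nat) (n : nat) a delta eps1 eps2 :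
  let rho := expR (- a) in
  let B := saddle_moment S rho 2 in
  let J := Num.sqrt (pi / (B / 2)) / 2 in
  0 < a <= 1 / 2 -> 0 < delta <= pi -> 0 < B -> all (fun s => 0 < s)%N S ->
  `|n%:R - saddle_moment S rho 1| <= 1 ->
  2 * a ^+ 2 + a * (2 * delta + saddle_moment S rho 3 * delta ^+ 3) + delta
    + a * (saddle_moment S rho 4 * delta ^+ 4) <= eps1 ->
  (forall t, delta <= t <= pi -> saddle_amp S rho t <= eps2) -> 0 <= eps2 ->
  `|\int[mu]_(t in `[0%R, pi]) diff_integrand S rho n t - a * J| <=
  4 * eps1 * delta + 3 * expR 16 * eps2 + 2 * expR (- (B * delta ^+ 2 / 4)) * (a * J).
Proof.
move=> rho B J a01 /andP[d0 d1] B0 S0 nM h1 h2 e20.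
move: (a01) => /andP[a0 a1].
have rho01 : 0 < rho < 1 by rewrite expR_gt0 expR_lt1 oppr_lt0 a0.
have M30 := saddle_moment_ge0 S 3 rho01.
have M40 := saddle_moment_ge0 S 4 rho01.
have e10 : 0 <= eps1.
  apply: le_trans h1; rewrite !addr_ge0// ?mulr_ge0 ?addr_ge0 ?mulr_ge0 ?exprn_ge0 ?(ltW a0) ?(ltW d0)//.
pose f := diff_integrand S rho n \_ `[0%R, pi].
have fE : \int[mu]_(t in `[0%R, pi]) diff_integrand S rho n t = \int[mu]_(t in `[0%R, +oo[) f t.
  rewrite -Rintegral_mkcondr; congr Rintegral.
  apply/seteqP; split => t /=; rewrite !in_itv/= ?andbT; last by case.
  by move=> h; split => //; case/andP: h.
rewrite fE.
have intf : mu.-integrable `[0%R, +oo[ (EFin \o f).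
  rewrite /f -restrict_EFin; apply: (@integrableS _ _ _ mu setT) => //.
  rewrite -integrable_mkcond//; apply: integrable_0pi.
  exact: continuous_diff_integrand.
have dd0 : 0 < delta ^- 2 by rewrite invr_gt0 exprn_gt0.
have B2 : 0 < B / 2 by lra.
have B4 : 0 < B / 4 by lra.
(* The three Gaussians dominate the local error on [[0, delta]], the integrand on [[delta, pi]]
   (where [1 <= e^16 e^{-t^2}] since [pi < 4]) and the tail of the main term. *)
have := @gaussian_comparison R f a (B / 2) (4 * eps1) (delta ^- 2) (3 * expR 16 * eps2) 1
  (a * expR (- (B * delta ^+ 2 / 4))) (B / 4) B2 dd0 ltr01 B4 intf.
rewrite -/J => main.
apply: le_trans (main _) _.
- move=> t t0.
  have g1 := expR_ge0 (- (delta ^- 2 * t ^+ 2)).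
  have g2 := expR_ge0 (- (1 * t ^+ 2)).
  have g3 := expR_ge0 (- (B / 4 * t ^+ 2)).
  rewrite -!/(gaussian _ _) in g1 g2 g3.
  have c20 : 0 <= 3 * expR 16 * eps2 by rewrite !mulr_ge0// expR_ge0.
  have c30 : 0 <= a * expR (- (B * delta ^+ 2 / 4)) by rewrite mulr_ge0 ?expR_ge0// ltW.
  have t2 := mulr_ge0 c20 g2; have t3 := mulr_ge0 c30 g3.
  have p0 := @pi_gt0 R; have p2 := @pihalf_lt2 R.
  case: (leP t delta) => td.
    have -> : f t = diff_integrand S rho n t.
      by rewrite /f patchE ifT// inE /= in_itv/= t0 (le_trans td).
    have hloc := saddle_integrand_gaussian (n := n) (erefl rho) a01 S0 nM t0.
    have tn j : t ^+ j <= delta ^+ j by apply: ler_exp.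
    have gd : 1 / 4 <= gaussian (delta ^- 2) t.
      apply: le_trans (expR_opp1_ge R) _; rewrite ler_expR lerN2.
      by rewrite ler_pdivrMl ?exprn_gt0// mulr1.
    have : `|diff_integrand S rho n t - a * gaussian (B / 2) t| <= eps1.
      apply: le_trans hloc _; apply: le_trans h1.
      have u3 := ler_wpM2l M30 (tn 3); have u4 := ler_wpM2l M40 (tn 4).
      have := ler_wpM2l (ltW a0) u3; have := ler_wpM2l (ltW a0) u4.
      by have := ler_wpM2l (ltW a0) (tn 1); move: td; rewrite !expr1; clear; lra.
    by have := ler_wpM2l e10 gd; move: t2 t3; clear; lra.
  (* Half of the exponent [B t^2 / 2] is estimated at [delta] and supplies the small factor; the
     other half keeps the bound integrable. *)
  have tail : a * gaussian (B / 2) t <= a * expR (- (B * delta ^+ 2 / 4)) * gaussian (B / 4) t.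
    rewrite -mulrA ler_pM2l// /gaussian -expRD ler_expR.
    have : delta ^+ 2 <= t ^+ 2 by apply: ler_exp; [exact: ltW|exact: ltW].
    have B0' := ltW B0.
    by move=> /(ler_wpM2l B0'); clear; lra.
  have ag0 : 0 <= a * gaussian (B / 2) t by rewrite mulr_ge0 ?expR_ge0// ltW.
  have t1 : 0 <= 4 * eps1 * gaussian (delta ^- 2) t by rewrite !mulr_ge0.
  case: (leP t pi) => tpi; last first.
    have -> : f t = 0.
      rewrite /f patchE ifF//; apply/negbTE; rewrite notin_setE /= in_itv/= => /andP[_].
      by rewrite leNgt tpi.
    rewrite sub0r normrN (ger0_norm ag0); move: tail t1 t2; clear; lra.
  have -> : f t = diff_integrand S rho n t.
    by rewrite /f patchE ifT// inE /= in_itv/= t0.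
  apply: le_trans (ler_normB _ _) _; rewrite (ger0_norm ag0).
  suff : `|diff_integrand S rho n t| <= 3 * expR 16 * eps2 * gaussian 1 t
    by move: tail t1; clear; lra.
  have /andP[A0 A1] := saddle_amp_itv t rho01 S0.
  have A2 : saddle_amp S rho t <= eps2 by apply: h2; rewrite (ltW td).
  have Q : `|rho^-1 * cos (n.+1%:R * t - saddle_phase S rho t)
      - cos (n%:R * t - saddle_phase S rho t)| <= 3.
    apply: le_trans (ler_normB _ _) _; rewrite normrM.
    have r2 : `|rho^-1| <= 2.
      rewrite /rho expRN invrK ger0_norm ?expR_ge0//.
      by apply: le_trans (expR_half_le2 R); rewrite ler_expR.
    have := ler_pM (normr_ge0 _) (normr_ge0 _) r2 (cos_max (n.+1%:R * t - saddle_phase S rho t)).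
    by have := cos_max (n%:R * t - saddle_phase S rho t); clear; lra.
  have g : 1 <= expR 16 * gaussian 1 t.
    rewrite /gaussian -expRD -[leLHS]expR0 ler_expR mul1r subr_ge0.
    have t4 : t <= 4 by move: tpi p2; clear; lra.
    by have := ler_exp 2 t0 t4; clear; lra.
  rewrite /diff_integrand normrM (ger0_norm (ltW A0)).
  apply: (@le_trans _ _ (eps2 * 3)); first by apply: ler_pM => //; exact: ltW.
  have -> : 3 * expR 16 * eps2 * gaussian 1 t = eps2 * 3 * (expR 16 * gaussian 1 t) by ring.
  by rewrite ler_peMr// mulr_ge0.
- have J0 : 0 <= J by rewrite divr_ge0// sqrtr_ge0.
  have sp := sqrt_pi_le2; have sp0 := sqrtr_ge0 (pi : R).
  apply: lerD; first apply: lerD.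
  + have -> : Num.sqrt (pi / delta ^- 2) = Num.sqrt pi * delta.
      by rewrite invrK sqrtrM ?pi_ge0// sqrtr_sqr (ger0_norm (ltW d0)).
    rewrite ler_wpM2l ?mulr_ge0//; have := ler_wpM2r (ltW d0) sp; clear; lra.
  + rewrite divr1 ler_piMr ?mulr_ge0 ?expR_ge0//; move: sp; clear; lra.
  + rewrite (gaussian_mass_scale B0).
    have s2 : Num.sqrt 2 <= 2 :> R.
      rewrite -[leRHS](@ger0_norm R)// -sqrtr_sqr ler_wsqrtr//; clear; lra.
    rewrite -[Num.sqrt 2 * _ / 2]mulrA -/J.
    have := expR_ge0 (- (B * delta ^+ 2 / 4)); set ex := expR _ => ex0.
    have -> : a * ex * (Num.sqrt 2 * J) = Num.sqrt 2 * (ex * (a * J)) by ring.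
    by rewrite -mulrA ler_wpM2r// mulr_ge0// mulr_ge0// ltW.
Qed.

End saddle_point_estimate.

Section finite_estimate.
Variable R : realType.
Implicit Types (a W : R).

Lemma saddle_error_bound (k : nat) : (0 < k)%N ->
  let e := (2 * k + 3)%N in
  exists C W0 : R, forall W, W0 <= W -> forall M n : nat, W ^+ (8 * e) <= M%:R ->
    let a := W ^- (8 * e * k) in
    let rho := expR (- a) in
    let S := prime_powers k M in
    let J := Num.sqrt (pi / (saddle_moment S rho 2 / 2)) / 2 in
    `|n%:R - saddle_moment S rho 1| <= 1 ->
    0 < saddle_moment S rho 2 /\
    `|\int[@lebesgue_measure R]_(t in `[0%R, pi]%classic) diff_integrand S rho n t - a * J|
      <= C * (a * J) * W ^- (8 * k.+1).
Proof.
move=> k0 e.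
(* The minor arcs must be negligible against [a * J * W^(-8(k+1))], and [a * J] is at least
   [a^2 v / 16] with [v = W^(-4e)]. This needs the exponent [16ek + 4e + 8(k+1)], which is at most
   [K]. *)
pose K := (8 * e + 16 * e * k)%N.
have [V1 hV1] := @minor_arc_bound R k K k0.
have e8 : (0 < 8 * e)%N by rewrite /e; lia.
have [V2 hV2] := prime_count_power R e8.
have i16 : 0 < 1 / 16 :> R by lra.
have [V3 hV3] := expR_eventually_ge (8 * k.+1) i16.
have n1 : (8 * k.+1 + 3 + 1 = 4 * e)%N.
  have : (8 * k.+1 + 4 = 4 * e)%N by rewrite /e; lia.
  lia.
have n2 : (4 * e <= 8 * e * k)%N by nia.
have n4 : (8 * e * k + (8 * e * k + 4 * e + 8 * k.+1) <= K)%N by rewrite /K; lia.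
have n3 : (8 * e = 4 * e * 2)%N by lia.
have [c3 c3E] : exists c3 : R, c3 = 4 * 8 ^+ 3 by eexists.
have [c4 c4E] : exists c4 : R, c4 = 4 * 8 ^+ 4 by eexists.
have c30 : 0 <= c3 by rewrite c3E mulr_ge0// exprn_ge0.
have c40 : 0 <= c4 by rewrite c4E mulr_ge0// exprn_ge0.
exists (4 * ((5 + c3 + c4) * 16) + 3 * expR 16 * 16 + 2), (Num.max (Num.max V1 V2) (Num.max V3 2)).
move=> W; rewrite !ge_max => /andP[/andP[WV1 WV2] /andP[WV3 W2]] M n WM a rho S J nM.
have W0 : 0 < W by lra.
have W1 : 1 <= W by lra.
have Wn m : 0 < W ^+ m by rewrite exprn_gt0.
have Wn1 m : 1 <= W ^+ m by rewrite exprn_ege1.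
have a0 : 0 < a by rewrite invr_gt0.
pose v := W ^- (4 * e).
have v0 : 0 < v by rewrite invr_gt0.
have av : a <= v by rewrite lef_pV2 ?posrE// ler_weXn2l.
have vW : W ^+ 3 * (W * v) = W ^- (8 * k.+1).
  rewrite /v -n1 !exprD expr1; field; rewrite !gt_eqF//.
have v1 : W ^+ 4 * v <= 1.
  have -> : W ^+ 4 * v = W ^+ 3 * (W * v) by ring.
  by rewrite vW invf_le1.
have vW1 : W * v <= 1.
  apply: le_trans v1; rewrite ler_pM2r// -[leLHS]expr1 ler_weXn2l//.
have v12 : v <= 1 / 2.
  have : 2 * v <= W * v by rewrite ler_pM2r.
  lra.
have a12 : 0 < a <= 1 / 2 by rewrite a0 (le_trans av).
have a1 : a <= 1 by move: av v12; clear; lra.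
pose Y := W ^+ (8 * e); have Y0 : 0 < Y by exact: Wn.
have aY : a * Y ^+ k = 1 by rewrite /a /Y -exprM mulVf// gt_eqF.
have YE : Y * v ^+ 2 = 1.
  by rewrite /Y n3 exprM -exprMn divff ?expr1n// gt_eqF.
have [Z [ZW Zc]] := hV2 _ WV2.
have rho01 : 0 < rho < 1 by rewrite expR_gt0 expR_lt1 oppr_lt0 a0.
have ZM : (Z <= M)%N by rewrite -(ler_nat R) (le_trans ZW).
have aZ : a * (Z ^ k)%N%:R <= 1 by rewrite natrX -[leRHS]aY ler_pM2l// ler_exp.
have hB := saddle_moment2_ge k0 a0 aZ ZM.
set B := saddle_moment S rho 2 in hB J *.
(* One power of [W] beyond [X^(-1-1/(2k))]. Its square gives [W^2], of which Chebyshev's bound for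
   [B] takes back one, leaving [B delta^2 >= W / 4]; the Gaussian tail is then smaller than any
   power of [W]. *)
pose delta := W * v * a.
have d0 : 0 < delta by rewrite /delta mulr_gt0// mulr_gt0.
have qW : W ^+ 2 * W ^+ (8 * e).-1 = W * Y.
  have -> : Y = W * W ^+ (8 * e).-1 by rewrite -exprS prednK.
  by rewrite mulrA -expr2.
have hBd : W / 4 <= B * delta ^+ 2.
  have h : W ^+ (8 * e).-1 / (4 * a ^+ 2) <= B.
    by apply: le_trans hB; rewrite ler_pM2r// invr_gt0 mulr_gt0// exprn_gt0.
  have := ler_wpM2r (sqr_ge0 delta) h; apply: le_trans.
  rewrite le_eqVlt; apply/orP; left; apply/eqP.
  have -> : W ^+ (8 * e).-1 / (4 * a ^+ 2) * delta ^+ 2 = (W ^+ 2 * W ^+ (8 * e).-1) * v ^+ 2 / 4.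
    by rewrite /delta; field; rewrite gt_eqF.
  by rewrite qW -[W * Y * _]mulrA YE mulr1.
have B0 : 0 < B.
  rewrite ltNge; apply/negP => B0; have := sqr_ge0 delta; nra.
split=> //.
have S0 : all (fun s => 0 < s)%N S := prime_powers_gt0 k M.
have p1 := @pihalf_ge1 R; have p2 := @pihalf_lt2 R.
have d01 : 0 < delta <= pi.
  rewrite d0 /= (@le_trans _ _ 1)//; last by move: p1; clear; lra.
  by rewrite /delta mulr_ile1// ?mulr_ge0 ?(ltW v0) ?(ltW W0) ?(ltW a0).
have M3 := saddle_moment_le M k0 Y0 a0 aY (isT : (3 <= 4)%N).
have M4 := saddle_moment_le M k0 Y0 a0 aY (isT : (4 <= 4)%N).
have M2 := saddle_moment_le M k0 Y0 a0 aY (isT : (2 <= 4)%N).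
rewrite -/rho -/S -/B -?c3E -?c4E in M2 M3 M4.
pose E := W ^- (8 * k.+1).
pose eps1 := (5 + c3 + c4) * a * (W ^+ 3 * v).
have h1 : 2 * a ^+ 2 + a * (2 * delta + saddle_moment S rho 3 * delta ^+ 3) + delta
    + a * (saddle_moment S rho 4 * delta ^+ 4) <= eps1.
  have d3 : saddle_moment S rho 3 * delta ^+ 3 <= c3 * (W ^+ 3 * v).
    apply: le_trans (ler_wpM2r (exprn_ge0 3 (ltW d0)) M3) _.
    have -> : c3 * Y / a ^+ 3 * delta ^+ 3 = c3 * (W ^+ 3 * v) * (Y * v ^+ 2).
      by rewrite /delta; field; rewrite gt_eqF.
    by rewrite YE mulr1.
  have d4 : saddle_moment S rho 4 * delta ^+ 4 <= c4 * (W ^+ 3 * v).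
    apply: le_trans (ler_wpM2r (exprn_ge0 4 (ltW d0)) M4) _.
    have -> : c4 * Y / a ^+ 4 * delta ^+ 4 = c4 * (W ^+ 3 * v) * (W * v) * (Y * v ^+ 2).
      by rewrite /delta; field; rewrite gt_eqF.
    by rewrite YE mulr1 ler_piMr// mulr_ge0// mulr_ge0 ?(ltW v0) ?(ltW (Wn _)).
  have w3 := Wn1 3%N.
  have w1 : W <= W ^+ 3 by rewrite -[leLHS]expr1 ler_weXn2l.
  have z1 : W * v <= W ^+ 3 * v by rewrite ler_pM2r.
  have z2 : v <= W ^+ 3 * v by rewrite ler_peMl// ltW.
  have dd : delta <= W ^+ 3 * v by rewrite /delta (le_trans _ z1)// ler_piMr ?mulr_ge0 ?(ltW W0) ?(ltW v0).
  have dd2 : delta <= a * (W ^+ 3 * v) by rewrite /delta mulrC ler_pM2l.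
  rewrite /eps1; move: d3 d4 dd dd2 z2; set x := W ^+ 3 * v => d3 d4 dd dd2 z2.
  have x1 := ler_wpM2l (ltW a0) d3; have x2 := ler_wpM2l (ltW a0) d4.
  have x3 := ler_wpM2l (ltW a0) dd; have x4 := ler_wpM2l (ltW a0) (le_trans av z2).
  rewrite expr2; move: x1 x2 x3 x4 dd2; clear; lra.
have e20 : 0 <= W ^- K by rewrite invr_ge0 ltW.
have h2 t : delta <= t <= pi -> saddle_amp S rho t <= W ^- K.
  move=> dt; apply: hV1 => //.
have := @saddle_integral_estimate R S n a delta eps1 (W ^- K) a12 d01 B0 S0 nM h1 h2 e20.
rewrite -/B -/J => h; apply: le_trans h _.
(* The upper bound on the second moment bounds the Gaussian mass from below, which turns absolute
   errors into relative ones. *)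
have Jlow : a * v <= 16 * J.
  have av0 : 0 <= a * v / 8 by rewrite divr_ge0// mulr_ge0 ?(ltW v0) ?(ltW a0).
  suff : a * v / 8 <= Num.sqrt (pi / (B / 2)) by rewrite /J; clear; lra.
  rewrite -(ger0_norm av0) -sqrtr_sqr ler_wsqrtr// ler_pdivlMr ?divr_gt0//.
  rewrite ler_pdivlMr ?exprn_gt0// in M2.
  have c2E : 4 * 8 ^+ 2 = 256 :> R by rewrite expr2 -!natrM.
  have : B * a ^+ 2 * v ^+ 2 <= 256.
    apply: le_trans (ler_wpM2r (sqr_ge0 v) M2) _.
    by rewrite -[leLHS]mulrA YE mulr1 c2E.
  have -> : (a * v / 8) ^+ 2 * (B / 2) = B * a ^+ 2 * v ^+ 2 / 128 by field.
  by move: p1; clear; lra.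
have J0 : 0 < a * J by rewrite pmulr_rgt0//; have := mulr_gt0 a0 v0; move: Jlow; clear; lra.
have -> : (4 * ((5 + c3 + c4) * 16) + 3 * expR 16 * 16 + 2) * (a * J) / W ^+ (8 * k.+1) =
    4 * ((5 + c3 + c4) * 16) * (a * J) * E + 3 * expR 16 * 16 * (a * J) * E + 2 * (a * J) * E.
  by rewrite -/E; ring.
apply: lerD; first apply: lerD.
- have -> : 4 * eps1 * delta = 4 * (5 + c3 + c4) * a * (a * v) * (W ^+ 3 * (W * v)).
    by rewrite /eps1 /delta; ring.
  rewrite vW -/E ler_wpM2r ?invr_ge0 ?(ltW (Wn _))//.
  have k0' : 0 <= 4 * (5 + c3 + c4) * a by rewrite !mulr_ge0 ?(ltW a0)//; move: c30 c40; clear; lra.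
  by have := ler_wpM2l k0' Jlow; clear; lra.
- have WK : W ^- K <= a * (a * v) * E.
    have -> : a * (a * v) * E = (W ^+ (8 * e * k + (8 * e * k + 4 * e + 8 * k.+1)))^-1.
      by rewrite /a /v /E !exprD; field; rewrite !gt_eqF.
    by rewrite lef_pV2 ?posrE ?Wn//; apply: (ler_weXn2l W1 n4).
  have c0 : 0 <= 3 * expR 16 :> R by rewrite mulr_ge0 ?expR_ge0.
  apply: le_trans (ler_wpM2l c0 WK) _.
  have -> : 3 * expR 16 * 16 * (a * J) * E = 3 * expR 16 * (a * (16 * J) * E) by ring.
  by rewrite ler_wpM2l// ler_wpM2r ?invr_ge0 ?(ltW (Wn _))// ler_pM2l.
- have ex : expR (- (B * delta ^+ 2 / 4)) <= E.
    rewrite expRN lef_pV2 ?posrE ?expR_gt0//; apply: le_trans (hV3 _ WV3) _.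
    by rewrite ler_expR; move: hBd; clear; lra.
  by have := ler_wpM2r (ltW J0) ex; clear; lra.
Qed.

Lemma pPk_diff_estimate (k : nat) : (0 < k)%N ->
  let e := (2 * k + 3)%N in
  exists C W0 : R, forall W, W0 <= W -> forall M n : nat, W ^+ (8 * e) <= M%:R -> (n.+1 < M)%N ->
    let a := W ^- (8 * e * k) in
    let rho := expR (- a) in
    let S := prime_powers k M in
    let main := rho ^- n * a * (\prod_(s <- S) (1 - rho ^+ s)^-1)
      / Num.sqrt (2 * pi * saddle_moment S rho 2) in
    `|n%:R - saddle_moment S rho 1| <= 1 ->
    `|((pPk k n.+1)%:R - (pPk k n)%:R) - main| <= C * main * W ^- (8 * k.+1).
Proof.
move=> k0 e; have [C [W0 H]] := saddle_error_bound k0.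
exists C, (Num.max W0 1) => W; rewrite ge_max => /andP[WW0 W1] M n WM nM a rho S main nM1.
have [B0 h] := H W WW0 M n WM nM1.
have a0 : 0 < a by rewrite invr_gt0 exprn_gt0//; lra.
have rho01 : 0 < rho < 1 by rewrite expR_gt0 expR_lt1 oppr_lt0 a0.
have mainE : main = rho ^- n * (\prod_(s <- S) (1 - rho ^+ s)^-1) / pi *
    (a * (Num.sqrt (pi / (saddle_moment S rho 2 / 2)) / 2)).
  rewrite /main -(gaussian_mass_main B0); ring.
rewrite (pPk_diff_integral k0 nM rho01) mainE -/S -mulrBr.
set c := _ / pi.
have c0 : 0 <= c.
  rewrite divr_ge0 ?pi_ge0// mulr_ge0 ?invr_ge0 ?exprn_ge0 ?expR_ge0//.
  rewrite big_seq prodr_ge0// => s sS; rewrite invr_ge0 subr_ge0 ltW//.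
  by have /andP[] := expr_pow_itv rho01 (allP (prime_powers_gt0 k M) s sS).
rewrite normrM (ger0_norm c0).
apply: le_trans (ler_wpM2l c0 h) _.
by rewrite -/rho -/S; set X := a * _; rewrite [c * (C * X / _)]mulrA [c * (C * X)]mulrCA lexx.
Qed.

End finite_estimate.

(** * The generating functions *)

Section power_series.
Variable R : realType.
Local Open Scope classical_set_scope.
Local Open Scope ring_scope.
Implicit Types (f : nat -> R) (x : R).

(** This class is stable under multiplication by powers of [m] and under termwise differentiation,
    and it ensures convergence on the open unit disc. *)
Definition poly_bounded f := exists C : R, exists d : nat, forall m, `|f m| <= C * m.+1%:R ^+ d.

(** Each of the [m + 1] terms of the partial geometric sum is at least [q^m]. *)
Lemma succ_geometric_le (q : R) (m : nat) : 0 <= q < 1 -> m.+1%:R * q ^+ m <= (1 - q)^-1.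
Proof.
move=> /andP[q0 q1]; have p0 : 0 < 1 - q by lra.
have h : m.+1%:R * q ^+ m <= \sum_(i < m.+1) q ^+ i.
  have -> : m.+1%:R * q ^+ m = \sum_(i < m.+1) q ^+ m.
    by rewrite sumr_const card_ord mulr_natl.
  by apply: ler_sum => i _; rewrite ler_wiXn2l ?(ltW q1)// -ltnS.
apply: le_trans h _; rewrite -[leRHS]mul1r ler_pdivlMr// mulrC.
rewrite -opprB mulNr -subrX1 opprB.
by rewrite gerBl exprn_ge0.
Qed.

Lemma cvg_poly_bounded_pseries f x : poly_bounded f -> `|x| < 1 -> cvgn (pseries f x).
Proof.
move=> [C [d fC]] x1.
pose K := (1 + `|x|) / 2; have x0 := normr_ge0 x.
have K01 : 0 < K < 1 by rewrite /K; apply/andP; split; lra.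
move: (K01) => /andP[K0 K1].
have xK : `|x| < `|K| by rewrite (ger0_norm (ltW K0)) /K; lra.
apply: is_cvg_pseries_inside xK; apply: normed_cvg.
(* [q] is the root of [K] of order [d + 1]: [d] of its powers absorb the polynomial factor, and the
   remaining one is the ratio of a convergent geometric series. *)
pose q := expR (ln K / d.+1%:R).
have q0 : 0 < q by rewrite expR_gt0.
have q1 : q < 1 by rewrite expR_lt1 pmulr_llt0 ?invr_gt0 ?ltr0n// ln_lt0.
have qK : q ^+ d.+1 = K.
  by rewrite -expRM_natr divfK ?pnatr_eq0// lnK ?posrE.
have C0 : 0 <= C by have := fC 0%N; rewrite expr1n mulr1; apply: le_trans.
have p0 : 0 < (1 - q)^-1 by rewrite invr_gt0; lra.
apply: (@series_le_cvg _ _ (geometric (C * (1 - q)^-1 ^+ d) q)) => /=.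
- by move=> n; exact: normr_ge0.
- by move=> n; rewrite /= !mulr_ge0 ?exprn_ge0 ?(ltW q0) ?(ltW p0).
- move=> n; rewrite /= normrM (ger0_norm (exprn_ge0 n (ltW K0))).
  apply: le_trans (ler_wpM2r (exprn_ge0 n (ltW K0)) (fC n)) _.
  rewrite -qK -exprM mulnC exprM.
  have -> : (q ^+ n) ^+ d.+1 = (q ^+ n) ^+ d * q ^+ n by rewrite exprSr.
  rewrite !mulrA ler_wpM2r ?exprn_ge0 ?(ltW q0)// -mulrA ler_wpM2l// -exprMn.
  apply: ler_exp; first by rewrite mulr_ge0 ?exprn_ge0 ?(ltW q0).
  by apply: succ_geometric_le; rewrite (ltW q0).
- by apply: is_cvg_geometric_series; rewrite ger0_norm ?(ltW q0).
Qed.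

Lemma poly_bounded_natM f (i : nat) : poly_bounded f -> poly_bounded (fun m => m%:R ^+ i * f m).
Proof.
move=> [C [d fC]]; exists C, (i + d)%N => m.
rewrite normrM ger0_norm ?exprn_ge0// exprD mulrCA ler_pM ?exprn_ge0//.
by apply: ler_exp => //; rewrite ler_nat.
Qed.

Lemma poly_bounded_diffs f : poly_bounded f -> poly_bounded (pseries_diffs f).
Proof.
move=> [C [d fC]]; exists (C * 2 ^+ d), d.+1 => m.
have C0 : 0 <= C by have := fC 0%N; rewrite expr1n mulr1; apply: le_trans.
rewrite /pseries_diffs normrM ger0_norm// exprS mulrCA ler_wpM2l//.
apply: le_trans (fC _) _; rewrite -mulrA ler_wpM2l// -exprMn; apply: ler_exp => //.
by rewrite -natrM ler_nat; lia.
Qed.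

Lemma is_derive_pseries f x : poly_bounded f -> `|x| < 1 ->
  is_derive x 1 (fun y => limn (pseries f y)) (limn (pseries (pseries_diffs f) x)).
Proof.
move=> pf x1; have x0 := normr_ge0 x.
pose K := (1 + `|x|) / 2.
have K0 : 0 <= K by rewrite /K; lra.
have K1 : `|K| < 1 by rewrite (ger0_norm K0) /K; lra.
have xK : `|x| < `|K| by rewrite (ger0_norm K0) /K; lra.
have pd := poly_bounded_diffs pf.
by apply: (@pseries_snd_diffs _ f K x) => //; apply: cvg_poly_bounded_pseries => //;
  exact: poly_bounded_diffs.
Qed.

Lemma pseries_euler f x : poly_bounded f -> `|x| < 1 ->
  x * limn (pseries (pseries_diffs f) x) = limn (pseries (fun m => m%:R * f m) x).
Proof.
move=> pf x1; apply/esym/cvg_lim => //.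
rewrite -cvg_shiftS.
have -> : [sequence pseries (fun m => m%:R * f m) x n.+1]_n =
    (fun n => x * pseries (pseries_diffs f) x n).
  apply/funext => n /=; rewrite /pseries /series /= big_nat_recl//= !mul0r add0r mulr_sumr.
  by apply: eq_bigr => i _; rewrite /pseries_diffs exprS; ring.
apply: cvgM; first exact: cvg_cst.
by apply: cvg_poly_bounded_pseries => //; exact: poly_bounded_diffs.
Qed.

(** For an array monotone in both indices, the iterated limit agrees with the diagonal one. This
    justifies summing the double series over [j] and [p] by rows, by columns or by the value of
    [j p^k]. *)
Lemma double_limit (T : nat -> nat -> R) (L : nat -> R) (F : R) :
  (forall J J' N, (J <= J')%N -> T J N <= T J' N) ->
  (forall J N N', (N <= N')%N -> T J N <= T J N') ->
  (forall J N, T J N <= F) -> (forall e, 0 < e -> exists n, F - e <= T n n) ->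
  (forall J, T J N @[N --> \oo] --> L J) -> L J @[J --> \oo] --> F.
Proof.
move=> T1 T2 TF Te TL.
have LF J : L J <= F by apply: (cvgr_to_le (TL J)); apply: nearW => N; exact: TF.
have TLle J N : T J N <= L J.
  apply: (cvgr_to_ge (TL J)); exists N => // N' /= NN'; exact: T2.
apply/cvgrPdist_le => e e0; have [n hn] := Te e e0.
exists n => // J /= nJ; rewrite ger0_norm ?subr_ge0//.
have := T1 n J n nJ; have := TLle J n; lra.
Qed.

End power_series.

Section prime_power_series.
Variables (R : realType) (k : nat).
Hypothesis k_gt0 : (0 < k)%N.
Local Open Scope classical_set_scope.
Local Open Scope ring_scope.
Implicit Types (h : nat -> R) (z : R).

(* [phi_coef m] is the coefficient of [z^m] in [Phi]; the term [j = 0] vanishes since [0^-1 = 0]. *)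
Definition pp_weight (j p : nat) : R := if prime p then j%:R^-1 else 0.
Definition phi_coef (m : nat) : R :=
  \sum_(j < m.+1) \sum_(p < m.+1) (if (j * p ^ k == m)%N then pp_weight j p else 0).
Definition pp_sum h (J N : nat) : R :=
  \sum_(j < J) \sum_(p < N) pp_weight j p * h (j * p ^ k)%N.

Lemma pp_weight_ge0 j p : 0 <= pp_weight j p.
Proof. by rewrite /pp_weight; case: ifP => // _; rewrite invr_ge0. Qed.

Lemma pp_weight_le1 j p : pp_weight j p <= 1.
Proof.
rewrite /pp_weight; case: ifP => // _; case: j => [|j]; first by rewrite invr0.
by rewrite invf_le1 ?ltr0n// ler1n.
Qed.

Lemma phi_coef_ge0 m : 0 <= phi_coef m.
Proof.
by apply: sumr_ge0 => j _; apply: sumr_ge0 => p _; case: ifP => // _; exact: pp_weight_ge0.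
Qed.

Lemma phi_coef_poly_bounded : poly_bounded phi_coef.
Proof.
exists 1, 2%N => m; rewrite mul1r ger0_norm ?phi_coef_ge0//.
apply: (@le_trans _ _ (\sum_(j < m.+1) \sum_(p < m.+1) 1)); last first.
  by rewrite !sumr_const card_ord -mulr_natr mulr_natr expr2 mulr_natr.
apply: ler_sum => j _; apply: ler_sum => p _; case: ifP => // _; exact: pp_weight_le1.
Qed.

Lemma phi_coef_widen m L : (m < L)%N ->
  phi_coef m = \sum_(j < L) \sum_(p < L) (if (j * p ^ k == m)%N then pp_weight j p else 0).
Proof.
move=> mL; rewrite /phi_coef.
have big0 j p : (m < j)%N || (m < p)%N ->
    (if (j * p ^ k == m)%N then pp_weight j p else 0) = 0.
  move=> h; case: eqP => // e; rewrite /pp_weight; case: ifP => // p_pr.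
  case: j e h => [|j] e h; first by rewrite invr0.
  have pk : (p <= p ^ k)%N by rewrite -{1}(expn1 p) leq_pexp2l// prime_gt0.
  have p0 := prime_gt0 p_pr; move: h; rewrite -e; nia.
pose G j p : R := if (j * p ^ k == m)%N then pp_weight j p else 0.
have inner j : \sum_(p < m.+1) G j p = \sum_(p < L) G j p.
  rewrite -(big_mkord xpredT (G j)) -(big_mkord xpredT (G j)).
  rewrite [RHS](@big_cat_nat _ _ _ m.+1)//= [X in _ + X]big_nat_cond [X in _ + X]big1 ?addr0//.
  by move=> p /andP[/andP[mp _] _]; rewrite /G big0// mp orbT.
rewrite (eq_bigr (fun j : 'I_m.+1 => \sum_(p < L) G j p)); last by move=> j _; exact: inner.
rewrite -(big_mkord xpredT (fun j => \sum_(p < L) G j p)).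
rewrite -[RHS](big_mkord xpredT (fun j => \sum_(p < L) G j p)).
rewrite [RHS](@big_cat_nat _ _ _ m.+1)//= [X in _ + X]big_nat_cond [X in _ + X]big1 ?addr0//.
move=> j /andP[/andP[mj _] _]; apply: big1 => p _; rewrite /G big0// mj//.
Qed.

Lemma phi_partial_sum h L :
  \sum_(m < L) h m * phi_coef m =
  \sum_(j < L) \sum_(p < L) (if (j * p ^ k < L)%N then pp_weight j p * h (j * p ^ k)%N else 0).
Proof.
rewrite (eq_bigr (fun m : 'I_L => \sum_(j < L) \sum_(p < L)
    (if (j * p ^ k == m)%N then pp_weight j p * h m else 0))); last first.
  move=> m _; rewrite (phi_coef_widen (ltn_ord m)) mulr_sumr; apply: eq_bigr => j _.
  rewrite mulr_sumr; apply: eq_bigr => p _; case: ifP => _; rewrite ?mulr0// mulrC//.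
rewrite exchange_big /=; apply: eq_bigr => j _; rewrite exchange_big /=; apply: eq_bigr => p _.
case: ltnP => jp.
  rewrite (bigD1 (Ordinal jp))//= eqxx big1 ?addr0// => m mjp; rewrite ifF//.
  by apply: contraNF mjp => /eqP e; apply/eqP/val_inj.
by rewrite big1// => m _; rewrite ifF//; apply/negbTE; rewrite gtn_eqF// (leq_trans (ltn_ord m)).
Qed.

Lemma pp_sum_le h J J' N N' : (forall m, 0 <= h m) -> (J <= J')%N -> (N <= N')%N ->
  pp_sum h J N <= pp_sum h J' N'.
Proof.
move=> h0 JJ NN; have t0 j p : 0 <= pp_weight j p * h (j * p ^ k)%N by rewrite mulr_ge0 ?pp_weight_ge0.
rewrite /pp_sum; apply: (@le_trans _ _ (\sum_(j < J) \sum_(p < N') pp_weight j p * h (j * p ^ k)%N)).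
  apply: ler_sum => j _.
  rewrite (big_ord_widen N' (fun p => pp_weight j p * h (j * p ^ k)%N))// big_mkcond /=.
  by apply: ler_sum => p _; case: ifP.
rewrite (big_ord_widen J' (fun j => \sum_(p < N') pp_weight j p * h (j * p ^ k)%N))// big_mkcond /=.
by apply: ler_sum => j _; case: ifP => // _; exact: sumr_ge0.
Qed.

(** A rectangle of pairs lies in the region [j p^k < L] for large [L], and the part of that region
    counted by the power series lies in the square of side [L]. *)
Lemma pp_sum_limit h (F : R) : (forall m, 0 <= h m) ->
  series (fun m => h m * phi_coef m) @ \oo --> F ->
  (forall J N, pp_sum h J N <= F) /\ (forall e, 0 < e -> exists n, F - e <= pp_sum h n n).
Proof.
move=> h0 hF; have t0 j p : 0 <= pp_weight j p * h (j * p ^ k)%N by rewrite mulr_ge0 ?pp_weight_ge0.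
have sE L : series (fun m => h m * phi_coef m) L = \sum_(m < L) h m * phi_coef m.
  by rewrite /series /= big_mkord.
have sF L : series (fun m => h m * phi_coef m) L <= F.
  apply: (cvgr_to_ge hF); exists L => // L' /= LL'.
  by apply: nondecreasing_series LL' => m _ _; rewrite mulr_ge0 ?phi_coef_ge0.
split=> [J N|e e0].
  pose L := (J * N ^ k + J + N)%N; apply: le_trans (sF L); rewrite sE phi_partial_sum.
  have JL : (J <= L)%N by rewrite /L; lia.
  have NL : (N <= L)%N by rewrite /L; lia.
  rewrite /pp_sum (big_ord_widen L (fun j => \sum_(p < N) pp_weight j p * h (j * p ^ k)%N))//.
  rewrite big_mkcond /=; apply: ler_sum => j _; case: ifP => [jJ|_]; last first.
    by apply: sumr_ge0 => p _; case: ifP.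
  rewrite (big_ord_widen L (fun p => pp_weight j p * h (j * p ^ k)%N))//.
  rewrite big_mkcond /=; apply: ler_sum => p _; case: ifP => [pN|_]; last by case: ifP.
  rewrite ifT//; have pk : (p ^ k <= N ^ k)%N by rewrite leq_exp2r// ltnW.
  have := leq_mul (ltnW jJ) pk; rewrite /L; lia.
have /cvgrPdist_le/(_ e e0)[n _ /(_ n (leqnn n))] := hF.
rewrite ger0_norm ?subr_ge0// => hn; exists n.
apply: (@le_trans _ _ (series (fun m => h m * phi_coef m) n)); first by lra.
rewrite sE phi_partial_sum /pp_sum; apply: ler_sum => j _; apply: ler_sum => p _.
by case: ifP.
Qed.

End prime_power_series.

(** * Limits over all primes of the moments and of the product *)

Section limits_of_products.
Variables (R : realType) (k : nat).
Hypothesis k_gt0 : (0 < k)%N.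
Local Open Scope classical_set_scope.
Local Open Scope ring_scope.
Implicit Types (z : R).

(** The power series of [(z d/dz)^i Phi]. Both the derivatives of [Phi] and the limits of the
    truncated moments are identified with it. *)
Definition phi_moment (i : nat) z : R := limn (pseries (fun m => m%:R ^+ i * @phi_coef R k m) z).

Lemma cvg_phi_moment (i : nat) z : 0 < z < 1 ->
  series (fun m => (m%:R ^+ i * z ^+ m) * phi_coef R k m) @ \oo --> phi_moment i z.
Proof.
move=> /andP[z0 z1]; rewrite /phi_moment.
have -> : (fun m => (m%:R ^+ i * z ^+ m) * phi_coef R k m) =
    (fun m => m%:R ^+ i * phi_coef R k m * z ^+ m) by apply/funext => m; ring.
apply: (cvg_poly_bounded_pseries (poly_bounded_natM i (phi_coef_poly_bounded R k))).
by rewrite ger0_norm// ltW.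
Qed.

Lemma cvg_sum_ord (n : nat) (P : pred nat) (u : nat -> nat -> R) (l : nat -> R) :
  (forall j, P j -> u j N @[N --> \oo] --> l j) ->
  \sum_(j < n | P j) u j N @[N --> \oo] --> \sum_(j < n | P j) l j.
Proof.
by move=> h; apply: cvg_big => [|i /h//]; exact: add_continuous.
Qed.

Lemma Phi_phi_moment z : 0 < z < 1 -> Phi k z = phi_moment 0 z.
Proof.
move=> z01; move: (z01) => /andP[z0 z1].
pose h m : R := m%:R ^+ 0 * z ^+ m.
have h0 m : 0 <= h m by rewrite /h expr0 mul1r exprn_ge0// ltW.
have [TF Te] := pp_sum_limit k_gt0 h0 (cvg_phi_moment (i := 0) z01).
pose u j N := \sum_(p < N) pp_weight R j p * h (j * p ^ k)%N.
have uE j N : u j N = \sum_(p < N | prime p) (j%:R^-1 * z ^+ (j * p ^ k)).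
  rewrite /u [RHS]big_mkcond; apply: eq_bigr => p _; rewrite /pp_weight /h expr0 mul1r.
  by case: ifP => // _; rewrite mul0r.
have u_nd j : nondecreasing_seq (u j).
  move=> N N' NN; rewrite /u (big_ord_widen N' (fun p => pp_weight R j p * h (j * p ^ k)%N))//.
  rewrite big_mkcond /=; apply: ler_sum => p _; case: ifP => // _.
  by rewrite mulr_ge0 ?pp_weight_ge0.
have u0 j N : 0 <= u j N by apply: sumr_ge0 => p _; rewrite mulr_ge0 ?pp_weight_ge0.
have u_cvg j : cvgn (u j).
  apply: nondecreasing_is_cvgn => //; exists (phi_moment 0 z) => _ [N _ <-].
  apply: le_trans (TF j.+1 N); rewrite /pp_sum big_ord_recr /= -/(u j N) lerDr.
  by apply: sumr_ge0 => i _; exact: u0.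
rewrite /Phi /sum_primes; apply/cvg_lim => //.
have -> : (fun J => \sum_(1 <= j < J) limn (fun N => \sum_(p < N | prime p) (j%:R^-1 * z ^+ (j * p ^ k)))) =
   (fun J => \sum_(j < J) limn (u j)).
  apply/funext => J; rewrite -[RHS](big_mkord xpredT (fun j => limn (u j))).
  case: J => [|J]; first by rewrite !big_geq.
  rewrite [RHS]big_ltn//.
  have -> : limn (u 0%N) = 0.
    apply/cvg_lim => //; have -> : u 0%N = fun=> 0 by apply/funext => N; rewrite uE big1// => p _; rewrite invr0 mul0r.
    exact: cvg_cst.
  rewrite add0r; apply: eq_bigr => j _; congr (limn _); apply/funext => N.
  by rewrite uE.
apply: (@double_limit R (pp_sum k h)) => //.
- by move=> J J' N JJ; exact: pp_sum_le.
- by move=> J N N' NN; exact: pp_sum_le.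
- move=> J; apply: (@cvg_sum_ord J xpredT u (fun j => limn (u j))) => j _; exact: u_cvg.
Qed.

(** Once the limit [l] is known to exist, shifting the index gives [l = z l + z / (1 - z)], which
    determines it. *)
Lemma cvg_sum_natM_geometric z : 0 < z < 1 ->
  \sum_(j < J) (j%:R * z ^+ j) @[J --> \oo] --> z / (1 - z) ^+ 2.
Proof.
move=> /andP[z0 z1].
have z1' : `|z| < 1 by rewrite ger0_norm// ltW.
have pb : poly_bounded (fun m => m%:R : R).
  by exists 1, 1%N => m; rewrite mul1r expr1 ger0_norm// ler_nat.
have := cvg_poly_bounded_pseries pb z1'; rewrite /pseries => cv.
have sE : series (fun i => i%:R * z ^+ i) = (fun J => \sum_(j < J) (j%:R * z ^+ j)).
  by apply/funext => J; rewrite /series /= big_mkord.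
rewrite sE in cv; set s := (fun J => _) in cv *; pose l := limn s.
have g : (fun J => z * series (geometric 1 z) J) @ \oo --> z * (1 * (1 - z)^-1).
  by apply: cvgM; [exact: cvg_cst|exact: cvg_geometric_series].
have rec : (fun J => s J.+1) = (fun J => z * s J + z * series (geometric 1 z) J).
  apply/funext => J; rewrite /s big_ord_recl /= mul0r add0r /series /= big_mkord -mulrDr -big_split /= mulr_sumr.
  apply: eq_bigr => j _; rewrite /bump /= add1n exprS -natr1 mul1r; ring.
have c1 : (fun J => s J.+1) @ \oo --> l by have := cv; rewrite -(cvg_shiftS s).
have c2 : (fun J => s J.+1) @ \oo --> z * l + z * (1 * (1 - z)^-1).
  by rewrite rec; apply: cvgD => //; apply: cvgM => //; exact: cvg_cst.
have lE : l = z * l + z * (1 * (1 - z)^-1) by apply: cvg_unique c1 c2.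
suff -> : z / (1 - z) ^+ 2 = l by [].
have d0 : 1 - z != 0 by rewrite gt_eqF// subr_gt0.
have : l * (1 - z) = z / (1 - z) by rewrite mulrBr mulr1 {1}lE; ring.
by move=> e; apply: (mulIf d0); rewrite e; field.
Qed.

(** Summing over [j] first, the prime power [s] contributes [s^i] times the sum of [j^(i-1) r^j]
    with [r = z^s]. This is [r / (1 - r)^i] for [i = 1] and [i = 2]; for larger [i] the closed form
    is different. *)
Lemma cvg_saddle_moment i z : 0 < z < 1 -> (1 <= i <= 2)%N ->
  saddle_moment (prime_powers k M) z i @[M --> \oo] --> phi_moment i z.
Proof.
move=> z01 i12; move: (z01) => /andP[z0 z1].
pose h m : R := m%:R ^+ i * z ^+ m.
have h0 m : 0 <= h m by rewrite /h mulr_ge0 ?exprn_ge0// ltW.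
have [TF Te] := pp_sum_limit k_gt0 h0 (cvg_phi_moment (i := i) z01).
apply: (@double_limit R (fun M J => pp_sum k h J M)) => //.
- by move=> J J' N JJ; exact: pp_sum_le.
- by move=> J N N' NN; exact: pp_sum_le.
move=> M; rewrite /saddle_moment big_prime_powers.
have -> : (fun J => pp_sum k h J M) =
    (fun J => \sum_(p < M | prime p) \sum_(j < J) j%:R^-1 * h (j * p ^ k)%N).
  apply/funext => J; rewrite /pp_sum exchange_big /= [RHS]big_mkcond; apply: eq_bigr => p _.
  case: ifP => pp; first by apply: eq_bigr => j _; rewrite /pp_weight pp.
  by rewrite big1// => j _; rewrite /pp_weight pp mul0r.
apply: (@cvg_sum_ord M prime (fun p J => \sum_(j < J) j%:R^-1 * h (j * p ^ k)%N)
  (fun p => z ^+ (p ^ k) / (1 - z ^+ (p ^ k)) ^+ i * (p ^ k)%N%:R ^+ i)) => p p_pr.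
set s := (p ^ k)%N; have s0 : (0 < s)%N by rewrite expn_gt0 prime_gt0.
have r01 := expr_pow_itv z01 s0; set r := z ^+ s in r01 *.
move: (r01) => /andP[r0 r1].
(* The index [j = 0] is set apart because for [i = 1] the power [0^0] would contribute 1, while the
   left side is 0. *)
have hE j : j%:R^-1 * h (j * s)%N = s%:R ^+ i * (if (j == 0)%N then 0 else j%:R ^+ i.-1 * r ^+ j).
  case: j => [|j]; first by rewrite invr0 mul0r mulr0.
  rewrite /h /= natrM exprMn [(j.+1 * s)%N]mulnC exprM -/r.
  case: i i12 {h h0 TF Te} => [//|i] _; rewrite /= [j.+1%:R ^+ i.+1]exprS.
  by rewrite !mulrA mulVf ?pnatr_eq0// mul1r [X in X * _]mulrC.
under eq_fun do under eq_bigr do rewrite hE.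
under eq_fun do rewrite -mulr_sumr.
rewrite mulrC; apply: cvgM; first exact: cvg_cst.
case: i i12 {h h0 TF Te hE} => [//|[_|[_|//]]] /=.
- rewrite expr1 -cvg_shiftS.
  have -> : [sequence \sum_(j < n.+1) (if j == 0%N :> nat then 0 else j%:R ^+ 0 * r ^+ j)]_n =
      series (geometric r r).
    apply/funext => J; rewrite /= big_ord_recl /= add0r /series /= big_mkord.
    by apply: eq_bigr => j _; rewrite /bump /= add1n expr0 mul1r exprS.
  by apply: cvg_geometric_series; rewrite ger0_norm// ltW.
- rewrite (_ : (fun J => _) = (fun J => \sum_(j < J) (j%:R * r ^+ j))).
    exact: cvg_sum_natM_geometric.
  apply/funext => J; apply: eq_bigr => j _.
  by case: eqP => [->|_]; rewrite ?mul0r// expr1.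
Qed.

Lemma Phi_derive1 z : 0 < z < 1 -> z * derive1 (Phi k) z = phi_moment 1 z.
Proof.
move=> z01; move: (z01) => /andP[z0 z1].
have z1' : `|z| < 1 by rewrite ger0_norm// ltW.
have pb := phi_coef_poly_bounded R k.
pose F := fun y => limn (pseries (fun m => m%:R ^+ 0 * phi_coef R k m) y).
have FE : (fun m => m%:R ^+ 0 * phi_coef R k m) = phi_coef R k.
  by apply/funext => m; rewrite expr0 mul1r.
have nz : \near z, F z = Phi k z.
  near=> y; rewrite Phi_phi_moment//; apply/andP; split; near: y.
  - exact: lt_nbhsr.
  - exact: lt_nbhsl.
rewrite derive1E -(near_eq_derive _ nz) /F FE.
have dF := is_derive_pseries pb z1'.
rewrite (@derive_val _ _ _ _ _ _ _ dF) pseries_euler//.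
Unshelve. all: by end_near. Qed.

Lemma Phi2_phi_moment z : 0 < z < 1 -> Phi2 k z = phi_moment 2 z.
Proof.
move=> z01; move: (z01) => /andP[z0 z1].
have z1' : `|z| < 1 by rewrite ger0_norm// ltW.
have pb := poly_bounded_natM 1 (phi_coef_poly_bounded R k).
have nz : \near z, phi_moment 1 z = z * derive1 (Phi k) z.
  near=> y; rewrite Phi_derive1//; apply/andP; split; near: y.
  - exact: lt_nbhsr.
  - exact: lt_nbhsl.
rewrite /Phi2 derive1E -(near_eq_derive _ nz).
have dF := is_derive_pseries pb z1'.
rewrite (@derive_val _ _ _ _ _ _ _ dF) pseries_euler//.
by rewrite /phi_moment; congr (limn (pseries _ _)); apply/funext => m; rewrite expr1 expr2 mulrA.
Unshelve. all: by end_near. Qed.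

(** The products increase since every factor is at least 1. They are bounded because, with
    [x = z^(p^k) <= z^p <= z], each factor is [1 + x / (1 - x) <= exp (z^p / (1 - z))], and these
    exponents are summable. *)
Lemma cvg_Psi z : 0 < z < 1 ->
  \prod_(s <- prime_powers k M) (1 - z ^+ s)^-1 @[M --> \oo] --> Psi k z.
Proof.
move=> z01; move: (z01) => /andP[z0 z1].
have -> : (fun M => \prod_(s <- prime_powers k M) (1 - z ^+ s)^-1) =
    (fun N => \prod_(p < N | prime p) (1 - z ^+ (p ^ k))^-1).
  by apply/funext => M; rewrite big_prime_powers.
set u := (fun N : nat => _).
have c0 : 0 < (1 - z)^-1 by rewrite invr_gt0 subr_gt0.
have s01 p : prime p -> 0 < z ^+ (p ^ k) < 1.
  by move=> pp; rewrite expr_pow_itv// expn_gt0 prime_gt0.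
have g1 p : prime p -> 1 <= (1 - z ^+ (p ^ k))^-1.
  by move=> /s01/andP[h1 h2]; rewrite -[leLHS]invr1 lef_pV2 ?posrE; lra.
suff : cvgn u by [].
apply: nondecreasing_is_cvgn.
  apply/nondecreasing_seqP => N; rewrite /u [leRHS]big_mkcond big_ord_recr /= -big_mkcond /=.
  case: ifP => pp; last by rewrite mulr1.
  by rewrite ler_peMr ?g1//; apply: prodr_ge0 => p /g1; apply: le_trans.
exists (expR ((1 - z)^-1 * (1 - z)^-1)) => _ [N _ <-].
apply: (@le_trans _ _ (\prod_(p < N | prime p) expR (z ^+ p * (1 - z)^-1))).
  apply: ler_prod => p pp; rewrite (le_trans ler01 (g1 _ pp))/=.
  have /andP[x0 x1] := s01 _ pp.
  have xz : z ^+ (p ^ k) <= z ^+ p.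
    by rewrite ler_wiXn2l ?(ltW z0) ?(ltW z1)// -{1}(expn1 p) leq_pexp2l// prime_gt0.
  have zz : z ^+ p <= z by rewrite -[leRHS]expr1 ler_wiXn2l ?(ltW z0) ?(ltW z1)// prime_gt0.
  apply: le_trans (expR_ge1Dx _).
  set x := z ^+ (p ^ k) in x0 x1 xz *.
  have -> : (1 - x)^-1 = 1 + x * (1 - x)^-1 by field; lra.
  rewrite lerD2l ler_pM ?(ltW x0)// ?invr_ge0 ?subr_ge0 ?(ltW x1)//.
  by rewrite lef_pV2 ?posrE; lra.
rewrite -expR_sum ler_expR -mulr_suml ler_pM2r//.
apply: (@le_trans _ _ (\sum_(p < N) z ^+ p)).
  by rewrite big_mkcond; apply: ler_sum => p _; case: ifP => // _; rewrite exprn_ge0// ltW.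
rewrite -[leRHS]mul1r ler_pdivlMr ?subr_gt0// mulrC.
by rewrite -opprB mulNr -subrX1 opprB gerBl exprn_ge0// ltW.
Qed.

End limits_of_products.

(** * Passage to all primes *)

Section uniform_estimate.
Variables (R : realType) (k : nat).
Hypothesis k_gt0 : (0 < k)%N.
Local Open Scope classical_set_scope.
Local Open Scope ring_scope.
Implicit Types (rho W Y : R).

Definition saddle_main (n : nat) rho : R :=
  rho ^- n * ln (rho^-1) * Psi k rho / Num.sqrt (2 * pi * Phi2 k rho).

Lemma Phi2_gt0 rho : 0 < rho < 1 -> 0 < Phi2 k rho.
Proof.
move=> rho01; move: (rho01) => /andP[r0 r1].
rewrite (Phi2_phi_moment k_gt0 rho01).
pose t s : R := rho ^+ s / (1 - rho ^+ s) ^+ 2 * s%:R ^+ 2.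
have tpos p : prime p -> 0 < t (p ^ k)%N.
  move=> p_pr; have s0 : (0 < p ^ k)%N by rewrite expn_gt0 prime_gt0.
  have /andP[h0 h1] := expr_pow_itv rho01 s0.
  by rewrite /t mulr_gt0 ?divr_gt0 ?exprn_gt0 ?subr_gt0// ltr0n.
apply: lt_le_trans (tpos 2%N isT) _.
apply: (cvgr_to_ge (cvg_saddle_moment k_gt0 rho01 (isT : (1 <= 2 <= 2)%N))).
exists 3%N => // M /= M3.
rewrite /saddle_moment big_prime_powers -(big_mkord prime (fun p => t (p ^ k)%N)).
rewrite (@big_cat_nat _ _ _ 3)//= big_ltn_cond//= big_ltn_cond//= big_ltn_cond//=.
rewrite big_geq// addr0 lerDl.
by apply: sumr_ge0 => p pp; rewrite ltW// tpos.
Qed.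

Lemma cvg_saddle_main (n : nat) rho : 0 < rho < 1 ->
  rho ^- n * ln (rho^-1) * (\prod_(s <- prime_powers k M) (1 - rho ^+ s)^-1)
      / Num.sqrt (2 * pi * saddle_moment (prime_powers k M) rho 2) @[M --> \oo] -->
  saddle_main n rho.
Proof.
move=> rho01; apply: cvgM.
  by apply: cvgM; [exact: cvg_cst|exact: cvg_Psi].
apply: cvgV.
  have p0 : 0 < 2 * pi :> R by rewrite mulr_gt0 ?pi_gt0.
  by rewrite gt_eqF// sqrtr_gt0 (mulr_gt0 p0)// Phi2_gt0.
apply: continuous_cvg; first exact: sqrt_continuous.
apply: cvgM; first exact: cvg_cst.
by rewrite Phi2_phi_moment//; exact: cvg_saddle_moment.
Qed.

(** This is [n = O(X^(1+1/k))]. It forces [W] to be large when [n] is, and later converts powers of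
    [W] into powers of [n]. *)
Lemma saddle_point_le (n : nat) a Y : 0 < a -> 0 < Y -> a * Y ^+ k = 1 ->
  expR (- a) * derive1 (Phi k) (expR (- a)) = n%:R -> n%:R <= 32 * Y / a.
Proof.
move=> a0 Y0 aY hn.
have rho01 : 0 < expR (- a) < 1 by rewrite expR_gt0 expR_lt1 oppr_lt0.
rewrite -hn Phi_derive1//.
apply: (cvgr_to_le (cvg_saddle_moment k_gt0 rho01 (isT : (1 <= 1 <= 2)%N))).
apply: nearW => M; apply: le_trans (saddle_moment_le M k_gt0 Y0 a0 aY (isT : (1 <= 4)%N)) _.
rewrite !expr1 le_eqVlt; apply/orP; left; apply/eqP; congr (_ * _ / _); lra.
Qed.

Lemma pPk_diff_saddle : exists C W0 : R, forall W, W0 <= W -> forall n : nat,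
    let a := W ^- (8 * (2 * k + 3) * k) in
    let rho := expR (- a) in
    rho * derive1 (Phi k) rho = n%:R ->
    `|((pPk k n.+1)%:R - (pPk k n)%:R) - saddle_main n rho| <=
      C * saddle_main n rho * W ^- (8 * k.+1).
Proof.
have [C [W0 H]] := pPk_diff_estimate R k_gt0.
exists C, (Num.max W0 1) => W; rewrite ge_max => /andP[WW0 W1] n a rho hn.
have a0 : 0 < a by rewrite invr_gt0 exprn_gt0//; lra.
have rho01 : 0 < rho < 1 by rewrite expR_gt0 expR_lt1 oppr_lt0 a0.
have aE : a = ln (rho^-1) by rewrite /rho expRN invrK expRK.
have cm := cvg_saddle_main (n := n) rho01.
set mainM := (fun M : nat => _) in cm.
have cl : `|((pPk k n.+1)%:R - (pPk k n)%:R) - mainM M| @[M --> \oo] -->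
    `|((pPk k n.+1)%:R - (pPk k n)%:R) - saddle_main n rho|.
  by apply: cvg_norm; apply: cvgB; [exact: cvg_cst|exact: cm].
have cr : C * mainM M * W ^- (8 * k.+1) @[M --> \oo] --> C * saddle_main n rho * W ^- (8 * k.+1).
  by apply: cvgM; [apply: cvgM; [exact: cvg_cst|exact: cm]|exact: cvg_cst].
apply: (ler_cvg_to cl cr).
have cn : saddle_moment (prime_powers k M) rho 1 @[M --> \oo] --> (n%:R : R).
  by rewrite -hn Phi_derive1//; exact: cvg_saddle_moment.
have /cvgrPdist_le/(_ 1 ltr01)[M0 _ hM0] := cn.
exists (maxn M0 (maxn n.+2 (Num.truncn (W ^+ (8 * (2 * k + 3)))).+1)) => // M /=.
rewrite !geq_max => /and3P[MM0 Mn MW].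
have WM : W ^+ (8 * (2 * k + 3)) <= M%:R.
  have W0' : 0 <= W ^+ (8 * (2 * k + 3)) by rewrite exprn_ge0//; lra.
  have /andP[_ h] := truncn_itv W0'.
  by apply: ltW; apply: lt_le_trans h _; rewrite ler_nat.
have := H W WW0 M n WM Mn (hM0 M MM0).
by rewrite /mainM -aE.
Qed.

Lemma powR_inv_natK (x : R) (d : nat) : 0 <= x -> (0 < d)%N -> (x ^+ d) `^ (1 / d%:R) = x.
Proof.
move=> x0 d0; rewrite -powR_mulrn// -powRrM mulrC divfK ?powRr1//.
by rewrite pnatr_eq0 -lt0n.
Qed.

Lemma powR_root_pow (x : R) (d : nat) : 0 <= x -> (0 < d)%N -> (x `^ (1 / d%:R)) ^+ d = x.
Proof.
move=> x0 d0; rewrite -powR_mulrn ?powR_ge0// -powRrM divfK ?powRr1//.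
by rewrite pnatr_eq0 -lt0n.
Qed.

End uniform_estimate.

Theorem theorem1p4 (R : realType) (k : nat) (hk : (1 <= k)%N) :
  exists C : R, exists N : nat, forall n : nat, (N <= n)%N ->
    forall rho : R, 0 < rho < 1 -> rho * derive1 (Phi k) rho = n%:R ->
      `| ((pPk k n.+1)%:R - (pPk k n)%:R)
         - rho ^- n * ln (rho^-1) * Psi k rho / Num.sqrt (2 * pi * Phi2 k rho) |
      <= C * (rho ^- n * ln (rho^-1) * Psi k rho / Num.sqrt (2 * pi * Phi2 k rho))
           * (n%:R `^ (- (1 / (2 * k + 3)%:R))).
Proof.
have [C [W0 H]] := @pPk_diff_saddle R k hk.
set e := (2 * k + 3)%N in H *.
pose U := Num.max W0 1.
have U1 : 1 <= U by rewrite le_max lexx orbT.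
pose V := 32 * U ^+ (8 * e * k.+1).
have V0 : 0 <= V by rewrite mulr_ge0// exprn_ge0//; lra.
(* The sign of [C] is not known, hence the norm; the factor 32 comes from the bound of [n] by
   [32 * W^(8e(k+1))]. *)
exists (`|C| * 32), (Num.truncn V).+1 => n nN rho rho01 hn.
move: (rho01) => /andP[r0 r1].
have r1' : 1 < rho^-1 by rewrite -invr1 ltf_pV2 ?posrE.
pose a := ln (rho^-1).
have a0 : 0 < a by rewrite ln_gt0.
have rhoE : rho = expR (- a) by rewrite /a lnV ?posrE// opprK lnK ?posrE.
have d0 : (0 < 8 * e * k)%N by rewrite /e; lia.
have e0 : (0 < e)%N by rewrite /e; lia.
pose W := a^-1 `^ (1 / (8 * e * k)%:R).
have ai0 : 0 < a^-1 by rewrite invr_gt0.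
have Wd : W ^+ (8 * e * k) = a^-1 by exact: (powR_root_pow (ltW ai0) d0).
have Wp : 0 < W by exact: powR_gt0.
have aE : W ^- (8 * e * k) = a by rewrite Wd invrK.
have aY : a * (W ^+ (8 * e)) ^+ k = 1 by rewrite -exprM Wd divff// gt_eqF.
have n_le : n%:R <= 32 * W ^+ (8 * e * k.+1).
  have := @saddle_point_le R k hk n a _ a0 (exprn_gt0 (8 * e) Wp) aY.
  by rewrite -rhoE => /(_ hn); rewrite -mulrA -Wd -exprD mulnS.
have Vn : V < n%:R.
  by have /andP[_ h] := truncn_itv V0; apply: lt_le_trans h _; rewrite ler_nat.
(* If [W < U], the bound on [n] would give [n <= V], against the choice of the threshold. *)
have UW : U <= W.
  rewrite leNgt; apply/negP => WU; have := lt_le_trans Vn n_le.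
  by rewrite /V ltr_pM2l// ltNge ler_exp ?ltW.
have WW0 : W0 <= W by apply: le_trans UW; rewrite le_max lexx.
have /= := H W WW0 n; rewrite aE -rhoE => /(_ hn) => h.
apply: le_trans h _.
rewrite -/(saddle_main k n rho).
have main0 : 0 <= saddle_main k n rho.
  rewrite /saddle_main divr_ge0// ?sqrtr_ge0// mulr_ge0//.
    by rewrite mulr_ge0 ?(ltW a0)// invr_ge0 exprn_ge0// ltW.
  apply: (cvgr_to_ge (cvg_Psi hk rho01)); apply: nearW => M.
  rewrite big_seq prodr_ge0// => s sS; rewrite invr_ge0 subr_ge0 ltW//.
  by have /andP[] := expr_pow_itv rho01 (allP (prime_powers_gt0 k M) s sS).
have n0 : 0 < n%:R :> R by apply: le_lt_trans Vn.
(* The power [1/e] of [32 * W^(8e(k+1))] is [32^(1/e) * W^(8(k+1))], and [32^(1/e) <= 32]. *)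
have errE : W ^- (8 * k.+1) <= 32 * n%:R `^ (- (1 / e%:R)).
  rewrite powRN ler_pdivlMr ?powR_gt0// mulrC ler_pdivrMr ?exprn_gt0//.
  have e10 : 0 <= 1 / e%:R :> R by rewrite divr_ge0.
  have N1 : (n%:R : R) \is Num.nneg by rewrite nnegrE ltW.
  have N2 : 32 * W ^+ (8 * e * k.+1) \is Num.nneg by rewrite nnegrE mulr_ge0// exprn_ge0// ltW.
  apply: le_trans (ge0_ler_powR e10 N1 N2 n_le) _.
  rewrite powRM// ?exprn_ge0 ?(ltW Wp)//.
  rewrite mulnAC exprM powR_inv_natK ?exprn_ge0 ?(ltW Wp)//.
  rewrite ler_wpM2r ?exprn_ge0 ?(ltW Wp)// ler1_powR//.
    by rewrite (ler_nat R 1 32).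
  by rewrite ler_pdivrMr ?ltr0n// mul1r ler1n.
apply: (@le_trans _ _ (`|C| * saddle_main k n rho * W ^- (8 * k.+1))).
  by rewrite ler_wpM2r ?invr_ge0 ?exprn_ge0 ?(ltW Wp)// ler_wpM2r// ler_norm.
have -> : `|C| * 32 * saddle_main k n rho * n%:R `^ (- (1 / e%:R)) =
  `|C| * saddle_main k n rho * (32 * n%:R `^ (- (1 / e%:R))) by ring.
by rewrite ler_wpM2l// mulr_ge0.
Qed.
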